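(* Let $(X,d)$ be a CAT(0) space and, for $x\in X$, let $(T_x,\rho)$ be the tangent cone of $X$ at $x$. Let $x_0\in X$, $t_1,t_2\in\mathbb{R}$, $\lambda\in\mathbb{R}$, and suppose $F:\mathbb{R}\times X\to\mathbb{R}$, with $F_t:=F(t,\cdot)$, satisfies: 1) $F$ is locally Lipschitz on $X$ (each $F_t$ is locally Lipschitz); 2) $F$ is $\lambda$-convex on $X$ (each $F_t$ is $\lambda$-convex); 3) there are $B>0$ and $\alpha>0$ such that $\rho\bigl(\nabla_x(-F_{t_1}),\nabla_x(-F_{t_2})\bigr)\le B|t_1-t_2|^\alpha$ for any $x\in X$. For $i=1,2$ let $\mu_i$ be the fixed-time $t_i$ gradient curve, i.e. the gradient curve of the function $x\mapsto F(t_i,x)$ defined on $I_{A(t_i)}$ (extended to $\overline{I_{A(t_i)}}$) with $\mu_i(0)=x_0$. Then there is a positive constant $T$ such that $$d(\mu_1(s),\mu_2(s))\le 2Bs|t_1-t_2|^\alpha$$ for all $s\in\overline{I_{A(t_1)}}\cap\overline{I_{A(t_2)}}\cap[0,T]$.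
   Context: CAT(0) space: a complete geodesic metric space $(X,d)$ (not necessarily locally compact) whose geodesic triangles are no fatter than their Euclidean comparison triangles. $[xy]$ is the unit-speed geodesic from $x$ to $y$. Tangent cone: the angle $\angle_x(\gamma_1,\gamma_2)$ of two geodesics starting at $x$ is the Alexandrov angle (limit of Euclidean comparison angles). $\Sigma_x$ is the completion, with respect to the intrinsic metric induced by $\angle_x$, of the set of geodesics starting at $x$ modulo $\angle_x=0$. $T_x$ is the Euclidean cone over $\Sigma_x$: elements are pairs $v=(\xi,r)$, $\xi\in\Sigma_x$, $r\ge0$, all $(\xi,0)$ being identified with the vertex $o_x$; $\rho$ is the cone metric; $\|(\xi,r)\|=r$; $\langle v,w\rangle=\|v\|\|w\|\cos\theta$ with $\theta$ the angle between $v$ and $w$ (and $0$ if $v$ or $w$ is $o_x$). Right-side tangent vector: a rectifiable curve $\gamma$ has right-side tangent vector $\gamma'(t+)=(\xi,r)\in T_{\gamma(t)}$ if $r=\lim_{t'\to t+}d(\gamma(t'),\gamma(t))/(t'-t)$ exists and $\xi=\lim_{t'\to t+}\xi_{t'}$ exists, where $\xi_{t'}$ is the direction at $\gamma(t)$ of $[\gamma(t)\gamma(t')]$ (if $r=0$, it is the vertex). $\lambda$-convexity: $G:X\to\mathbb{R}$ is $\lambda$-convex if for all $x_0,x_1\in X$, $t\in[0,1]$ and $x_t$ the point of $[x_0x_1]$ with $d(x_0,x_t)=t\,d(x_0,x_1)$, one has $G(x_t)\le(1-t)G(x_0)+tG(x_1)-t(1-t)\lambda d^2(x_0,x_1)/2$.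 Gradient: for $G$ locally Lipschitz and $\lambda$-convex, the differential $d_xG:T_x\to\mathbb{R}$ is the unique Lipschitz function with $d_xG(\gamma'(0+))=\lim_{t\to0+}(G(\gamma(t))-G(\gamma(0)))/t$ for every curve $\gamma$ with $\gamma(0)=x$ for which $\gamma'(0+)$ is defined; the downward gradient vector $\nabla_x(-G)$ is the unique $v\in T_x$ with $d_xG(w)\ge-\langle v,w\rangle$ for all $w\in T_x$ and $d_xG(v)=-\langle v,v\rangle$. A gradient curve of $G$ is a locally Lipschitz curve $\gamma$ with $\gamma'(t+)$ existing and equal to $\nabla_{\gamma(t)}(-G)$ for all $t$ in its domain other than the right endpoint. Domain: $A(t)=-\min\{0,\liminf_{d(x,y)\to\infty}F(t,x)/d^2(x,y)\}$ (with $y\in X$ fixed; independent of $y$), $I_{A(t)}=(0,\infty)$ if $A(t)=0$ and $I_{A(t)}=(0,1/(16A(t))]$ if $A(t)>0$; $\overline{I_{A(t)}}$ is its closure. By a theorem of Mayer, for each $t$ and $x_0$ there is a unique gradient curve of $F_t$ on $\overline{I_{A(t)}}$ starting at $x_0$. *)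

(* Defs.v *)
(* The reals are an abstract R : realType of MathComp-Analysis. *)
From mathcomp Require Import all_boot all_order all_algebra.
From mathcomp Require Import all_classical all_reals all_analysis.

Set Implicit Arguments.
Unset Strict Implicit.
Unset Printing Implicit Defensive.

Import Order.TTheory GRing.Theory Num.Theory.
Import numFieldNormedType.Exports.

Local Open Scope classical_set_scope.
Local Open Scope ring_scope.

Section CurveLength.
Context {R : realType} {T : Type}.

(* An extended real; [dist] need not be a distance (it is also used with the
   Alexandrov angle, which only separates points up to angle 0). *)
Definition curve_length (dist : T -> T -> R) (c : R -> T) (a b : R) : \bar R :=
  ereal_sup [set (\sum_(i < size s)
                    dist (c (nth b (a :: s) i)) (c (nth b (a :: s) i.+1)))%:E
            | s in itv_partition a b].

End CurveLength.

Section Geometry.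
Context {R : realType} {X : metricType R}.
Implicit Types (x y z : X) (g : R -> X).

Definition isometric_on g (l : R) : Prop :=
  forall s t, 0 <= s <= l -> 0 <= t <= l -> mdist (g s) (g t) = `|s - t|.

Definition geodesic x y g : Prop :=
  [/\ g 0 = x, g (mdist x y) = y & isometric_on g (mdist x y)].

Definition eucl_dist (p q : R * R) : R :=
  Num.sqrt ((p.1 - q.1) ^+ 2 + (p.2 - q.2) ^+ 2).

(* Any two sides of a triangle share a vertex, so up to renaming the vertices
   the two compared points lie on sides [xy] and [xz]; two points on a same
   side are always at the distance of their comparison points.  [p] is the
   comparison point of [gxy s]: the point of the Euclidean segment [x' y'] at
   distance [s] from [x'], and likewise [q] for [gxz t]. *)
Definition thin_triangles : Prop :=
  forall x y z gxy gxz gyz,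
    geodesic x y gxy -> geodesic x z gxz -> geodesic y z gyz ->
  forall x' y' z' : R * R,
    eucl_dist x' y' = mdist x y -> eucl_dist x' z' = mdist x z ->
    eucl_dist y' z' = mdist y z ->
  forall (s t : R) (p q : R * R),
    0 <= s <= mdist x y -> 0 <= t <= mdist x z ->
    eucl_dist x' p = s -> eucl_dist p y' = mdist x y - s ->
    eucl_dist x' q = t -> eucl_dist q z' = mdist x z - t ->
  mdist (gxy s) (gxz t) <= eucl_dist p q.

Definition CAT0 : Prop :=
  [/\ forall F : set_system X, ProperFilter F -> cauchy F -> exists x, F --> x,
      forall x y, exists g, geodesic x y g
    & thin_triangles].

Definition comparison_angle x y z : R :=
  acos ((mdist x y ^+ 2 + mdist x z ^+ 2 - mdist y z ^+ 2)
        / (2 * mdist x y * mdist x z)).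

Record geodesic_from x := GeodesicFrom {
  gcurve :> R -> X ;
  glen : R ;
  glen_gt0 : 0 < glen ;
  gcurve0 : gcurve 0 = x ;
  gcurve_iso : isometric_on gcurve glen }.

Definition angle x (g h : geodesic_from x) : R :=
  lim (comparison_angle x (g st.1) (h st.2) @[st --> (0^'+, 0^'+)]).

(* Germs of geodesics are represented by geodesics; two geodesics at angle 0
   are at intrinsic distance 0. *)
Definition angle_path x (g h : geodesic_from x) (c : R -> geodesic_from x) :=
  [/\ c 0 = g, c 1 = h
    & forall s, 0 <= s <= 1 ->
        angle (c u) (c s) @[u --> within `[0, 1] (nbhs s)] --> (0 : R)].

(* The length metric induced by the angle; it is +oo when no path exists. *)
Definition intrinsic_dist x (g h : geodesic_from x) : \bar R :=
  ereal_inf [set curve_length (@angle x) c 0 1 | c in angle_path g h].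

Definition seq_dist x (a b : nat -> geodesic_from x) : \bar R :=
  lim (intrinsic_dist (a n) (b n) @[n --> \oo]).

(* The completion Sigma_x, presented by Cauchy sequences: [direction x] is
   the (extended) pseudometric space of Cauchy sequences with [seq_dist], and
   two sequences at distance 0 represent the same point of Sigma_x. *)
Record direction x := Direction {
  dseq :> nat -> geodesic_from x ;
  dseq_cauchy : forall e : R, 0 < e -> exists N, forall m n,
    (N <= m)%N -> (N <= n)%N -> (intrinsic_dist (dseq m) (dseq n) < e%:E)%E }.

(* Angle in the Euclidean cone over Sigma_x: distances are cut off at pi. *)
Definition cone_angle x (xi eta : direction x) : R :=
  fine (Order.min (seq_dist xi eta) pi%:E).

(* T_x is presented by a pseudometric space too: v and w represent the same
   vector when [cone_dist v w = 0]; in particular every [Tvec xi 0] is the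
   vertex.  The separate constructor provides a vertex when Sigma_x is empty. *)
Variant tangent x := Vertex | Tvec of direction x & {nonneg R}.

Definition tnorm x (v : tangent x) : R :=
  if v is Tvec _ r then r%:num else 0.

Definition tprod x (v w : tangent x) : R :=
  match v, w with
  | Tvec xi r, Tvec eta s => r%:num * s%:num * cos (cone_angle xi eta)
  | _, _ => 0
  end.

Definition cone_dist x (v w : tangent x) : R :=
  Num.sqrt (tnorm v ^+ 2 + tnorm w ^+ 2 - 2 * tprod v w).

Definition rectifiable g (a b : R) : Prop :=
  {within `[a, b], continuous g} /\ (curve_length mdist g a b < +oo)%E.

(* The curve g, with g t = x, has right-side tangent vector v at time t.  The
   function dir gives, for t' near t+, the geodesic [x, g t']. *)
Definition right_tangent g (t : R) x (v : tangent x) : Prop :=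
  [/\ g t = x,
      mdist (g t') x / (t' - t) @[t' --> t^'+] --> tnorm v
    & match v with
      | Tvec xi r => 0 < r%:num -> exists dir : R -> geodesic_from x,
          (\forall t' \near t^'+, dir t' (glen (dir t')) = g t') /\
          seq_dist (cst (dir t')) xi @[t' --> t^'+] --> 0%E
      | Vertex => True
      end].

Definition locally_lipschitz (G : X -> R) : Prop :=
  forall x, exists K, \forall y & z \near x, `|G y - G z| <= K * mdist y z.

Definition lambda_convex (lambda : R) (G : X -> R) : Prop :=
  forall x0 x1 g (t : R), geodesic x0 x1 g -> 0 <= t <= 1 ->
  G (g (t * mdist x0 x1)) <=
    (1 - t) * G x0 + t * G x1 - t * (1 - t) * lambda * mdist x0 x1 ^+ 2 / 2.

Definition is_differential (G : X -> R) x (D : tangent x -> R) : Prop :=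
  (exists K, forall v w, `|D v - D w| <= K * cone_dist v w) /\
  (forall g v, (exists2 e, 0 < e & rectifiable g 0 e) -> right_tangent g 0 v ->
     (G (g t) - G (g 0)) / t @[t --> 0^'+] --> D v).

(* v is the downward gradient vector of G at x. *)
Definition is_down_gradient (G : X -> R) x (v : tangent x) : Prop :=
  exists D, [/\ is_differential G D,
                forall w, D w >= - tprod v w
              & D v = - tprod v v].

(* Gradient curve of G with domain the interval I. *)
Definition gradient_curve (G : X -> R) (I : set R) (mu : R -> X) : Prop :=
  (forall t, I t -> exists2 e, 0 < e & exists K, forall s s',
     I s -> I s' -> `|s - t| < e -> `|s' - t| < e ->
     mdist (mu s) (mu s') <= K * `|s - s'|) /\
  (forall t, I t -> (exists2 t', I t' & t < t') ->
     exists v : tangent (mu t), right_tangent mu t v /\ is_down_gradient G v).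

(* Filter base for d(x, y) -> oo; it is improper when X is bounded, and the
   lower limit below is then +oo. *)
Definition far_from y : set_system X :=
  [set V | exists M, forall x, M < mdist x y -> V x].

(* A(t) for G = F_t, with base point y. *)
Definition growth (G : X -> R) y : \bar R :=
  (- Order.min 0 (limf_einf (fun x => (G x / mdist x y ^+ 2)%:E)
                            (far_from y)))%E.

End Geometry.

Definition time_interval {R : realType} (A : \bar R) : set R :=
  if A == 0%E then [set` `]0, +oo[] else [set` `]0, (16 * fine A)^-1]].

(* Main.v *)
Require Import Defs.
From mathcomp Require Import all_boot all_order all_algebra.
From mathcomp Require Import all_classical all_reals all_analysis.
From mathcomp Require Import ring lra.

(** Let [D s] be the distance between the two curves at time [s], and [beta]
    the bound on the distance of the two gradients.  It suffices to show that
    the upper right derivative of [D] is at most [|lambda| * D + beta]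
    ([gradient_curves_mdist_growth]): as [D 0 = 0], a Gronwall argument gives
    [D s <= 2 * beta * s] on a time interval whose length depends only on
    [lambda] ([linear_growth_bound]).

    The derivative is estimated by a first variation argument along the
    geodesic from [x], the first curve, to [y], the second one.  If both moved
    along the gradients of the same function [F2], the first variation formula
    ([ray_mdist_geodesic]) would bound it by the sum of the slopes of [F2] at
    the ends of the geodesic in the direction of its interior, and by
    [lambda]-convexity this sum is at most [- lambda * D]
    ([down_gradient_slope]).  Replacing the gradient of [F1] at [x] by that of
    [F2] costs at most [beta], since rays separate no faster than their initial
    vectors in the tangent cone ([ray_mdist_near]).

    The delicate point is to place the curves near geodesics.  Directions are
    compared by angles, and angles bound distances from below: that a curve has
    a right tangent vector does not, in itself, put it close to a geodesic with
    nearly the same direction.  For a gradient curve of a convex function [G]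
    it does ([gradient_curve_ray]): the curve and a geodesic approximating the
    gradient both decrease [G] at nearly the maximal possible rate, hence so
    does their midpoint, and the median inequality of a CAT(0) space then
    forces them together.

    Directions, moreover, are limits of geodesics for the length metric of the
    angle.  The limits in the definition of the tangent cone exist thanks to
    the triangle inequality of Alexandrov angles ([angle_triangle]), which
    comes from the triangle inequality of [X] on small triangles; and since an
    angle is at most the corresponding intrinsic distance, the cone metric
    bounds the distance of geodesics from above. *)

Set Implicit Arguments.
Unset Strict Implicit.
Unset Printing Implicit Defensive.

Import Order.TTheory GRing.Theory Num.Theory.
Import numFieldNormedType.Exports.

Local Open Scope classical_set_scope.
Local Open Scope ring_scope.

(** * Comparison triangles *)

Lemma eucl_dist_eq (R : realType) (p q : R * R) (r : R) : 0 <= r ->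
  (p.1 - q.1) ^+ 2 + (p.2 - q.2) ^+ 2 = r ^+ 2 -> eucl_dist p q = r.
Proof. by move=> r0 E; rewrite /eucl_dist E sqrtr_sqr ger0_norm. Qed.

Section Geodesics.
Context {R : realType} {X : metricType R}.
Implicit Types (x y z : X) (g : R -> X).

Lemma isometric_onW g (l l' : R) : l' <= l ->
  isometric_on g l -> isometric_on g l'.
Proof.
by move=> ll' ig s t /andP[s0 sl] /andP[t0 tl]; apply: ig;
  rewrite ?s0 ?t0/= (le_trans _ ll').
Qed.

Lemma mdist_isometric_on0 g (l s : R) : isometric_on g l -> 0 <= s <= l ->
  mdist (g 0) (g s) = s.
Proof.
move=> ig /andP[s0 sl]; rewrite ig ?s0 ?lexx ?(le_trans s0)//.
by rewrite sub0r normrN ger0_norm.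
Qed.

Lemma isometric_on_geodesic g (l s : R) : isometric_on g l -> 0 <= s <= l ->
  geodesic (g 0) (g s) g.
Proof.
move=> ig sl; rewrite /geodesic (mdist_isometric_on0 ig sl); split=> //.
by apply: isometric_onW ig; case/andP: sl.
Qed.

Lemma geodesic_rev x y g : geodesic x y g ->
  geodesic y x (fun t => g (mdist x y - t)).
Proof.
move=> [g0 g1 ig]; rewrite /geodesic (metric_sym y x) subr0 subrr; split=> //.
move=> s t /andP[s0 sl] /andP[t0 tl]; rewrite ig; first 1 last.
- by rewrite subr_ge0 sl gerBl.
- by rewrite subr_ge0 tl gerBl.
by rewrite distrC; congr `|_|; ring.
Qed.

Lemma ler_mdist x y z : `|mdist x y - mdist x z| <= mdist y z.
Proof.
have := metric_triangle x y z; have := metric_triangle x z y.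
by rewrite (metric_sym z y) ler_norml; move=> *; apply/andP; split; lra.
Qed.

End Geodesics.

Section CAT0_comparison.
Context {R : realType} {X : metricType R} (hX : @CAT0 R X).
Implicit Types (x y z : X) (g : R -> X).

(** In the Euclidean triangle with the same side lengths the cosine at [x] is
    half of the last quotient, and the right-hand side is the squared distance
    of the two comparison points.  The comparison triangle has [x] at the
    origin and [y] on the first axis. *)
Lemma CAT0_law_of_cosines x y z gxy gxz (s t : R) :
  x != y -> x != z -> geodesic x y gxy -> geodesic x z gxz ->
  0 <= s <= mdist x y -> 0 <= t <= mdist x z ->
  mdist (gxy s) (gxz t) ^+ 2 <= s ^+ 2 + t ^+ 2 - s * t *
   ((mdist x y ^+ 2 + mdist x z ^+ 2 - mdist y z ^+ 2) / (mdist x y * mdist x z)).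
Proof.
move=> xy xz Gxy Gxz /[dup] hs /andP[s0 sa] /[dup] ht /andP[t0 tb].
have [_ /(_ y z)[gyz Gyz] thin] := hX.
have {}thin := thin _ _ _ _ _ _ Gxy Gxz Gyz.
have a0 : 0 < mdist x y by rewrite mdist_gt0.
have b0 : 0 < mdist x z by rewrite mdist_gt0.
have c0 : 0 <= mdist y z := mdist_ge0 y z.
have := ler_mdist x y z; rewrite ler_norml.
have := metric_triangle y x z; rewrite (metric_sym y x).
move: thin hs ht sa tb a0 b0 c0.
have := mdist_ge0 (gxy s) (gxz t).
set a := mdist x y; set b := mdist x z; set c := mdist y z.
set d := mdist (gxy s) (gxz t).
move=> d0 thin hs ht sa tb a0 b0 c0 cab /andP[abc bac].
pose u := (a ^+ 2 + b ^+ 2 - c ^+ 2) / (2 * a).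
have aN0 : a != 0 by rewrite gt_eqF.
have bN0 : b != 0 by rewrite gt_eqF.
have uE : 2 * a * u = a ^+ 2 + b ^+ 2 - c ^+ 2 by rewrite /u; field.
have ub : u ^+ 2 <= b ^+ 2.
  rewrite -subr_ge0 subr_sqr; apply: mulr_ge0.
    by rewrite -(pmulr_rge0 _ (_ : 0 < 2 * a)) ?mulr_gt0// mulrBr uE; nra.
  by rewrite -(pmulr_rge0 _ (_ : 0 < 2 * a)) ?mulr_gt0// mulrDr uE; nra.
pose v := Num.sqrt (b ^+ 2 - u ^+ 2).
have vE : v ^+ 2 = b ^+ 2 - u ^+ 2 by rewrite sqr_sqrtr// subr_ge0.
have dle : d <= eucl_dist (s, 0) (t / b * u, t / b * v).
  apply: (thin (0, 0) (a, 0) (u, v)) => //; apply: eucl_dist_eq => //=.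
  - exact: ltW.
  - by rewrite subrr sub0r sqrrN expr0n addr0.
  - exact: ltW.
  - by rewrite !sub0r !sqrrN vE; ring.
  - by rewrite sub0r sqrrN vE; lra.
  - by rewrite subrr sub0r sqrrN expr0n addr0.
  - by rewrite subr_ge0.
  - by rewrite subrr expr0n addr0 -sqrrN opprB.
  - transitivity ((t / b) ^+ 2 * (u ^+ 2 + v ^+ 2)); first by ring.
    rewrite vE; field.
    exact: bN0.
  - by rewrite subr_ge0.
  - transitivity ((t / b - 1) ^+ 2 * (u ^+ 2 + v ^+ 2)); first by ring.
    rewrite vE; field.
    exact: bN0.
apply: (@le_trans _ _ (eucl_dist (s, 0) (t / b * u, t / b * v) ^+ 2)).
  by rewrite lerXn2r ?nnegrE// sqrtr_ge0.
rewrite /eucl_dist sqr_sqrtr ?addr_ge0 ?sqr_ge0//= le_eqVlt; apply/orP; left.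
apply/eqP; transitivity (s ^+ 2 - 2 * s * (t / b) * u + (t / b) ^+ 2 * (u ^+ 2 + v ^+ 2)).
  by ring.
rewrite vE -uE; field.
by apply/andP; split.
Qed.

(** The Bruhat--Tits inequality: the law of cosines at [x], applied to the
    midpoint of [[x y]] and to the endpoint [z] of [[x z]]; in the Euclidean
    plane it is the formula for the length of a median. *)
Lemma CAT0_median x y z g : geodesic x y g ->
  mdist (g (mdist x y / 2)) z ^+ 2 <=
  mdist x z ^+ 2 / 2 + mdist y z ^+ 2 / 2 - mdist x y ^+ 2 / 4.
Proof.
move=> G; have [xy|xy] := eqVneq x y.
  move: G; rewrite -xy => -[g0 _ _]; rewrite mdistxx mul0r g0.
  by rewrite expr0n/=; lra.
have [xz|xz] := eqVneq x z.
  have [g0 _ ig] := G; have := mdist_ge0 x y => d0.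
  have h : 0 <= mdist x y / 2 <= mdist x y by apply/andP; split; lra.
  have := mdist_isometric_on0 ig h; rewrite g0 => E.
  rewrite -xz mdistxx metric_sym E (metric_sym y x) exprMn expr0n/=.
  by rewrite exprVn; lra.
have [_ /(_ x z)[h H] _] := hX; have [_ hz _] := H.
have hs : 0 <= mdist x y / 2 <= mdist x y.
  by have := mdist_ge0 x y => d0; apply/andP; split; lra.
have ht : 0 <= mdist x z <= mdist x z by rewrite mdist_ge0 lexx.
have := CAT0_law_of_cosines xy xz G H hs ht; rewrite hz => /le_trans; apply.
have a0 : mdist x y != 0 by rewrite gt_eqF ?mdist_gt0.
have b0 : mdist x z != 0 by rewrite gt_eqF ?mdist_gt0.
rewrite le_eqVlt; apply/orP; left; apply/eqP; field.
by apply/andP; split.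
Qed.

End CAT0_comparison.

(** * Alexandrov angles as limits of comparison angles *)

Section RealLine.
Context {R : realType}.
Implicit Types P : R -> Prop.

Lemma near_at_rightP (a : R) P : (\forall t \near a^'+, P t) <->
  exists2 d, 0 < d & forall h, 0 < h < d -> P (a + h).
Proof.
split.
  move=> /nbhs_ballP[d /= d0 dP]; exists d => // h /andP[h0 hd].
  by apply: dP; rewrite ?ltrDl// /ball/= opprD addNKr normrN gtr0_norm.
move=> [d d0 dP]; apply/nbhs_ballP; exists d => //= t; rewrite /ball/= => td a0.
have -> : t = a + (t - a) by ring.
apply: dP; rewrite subr_gt0 a0/=.
by move: td; rewrite distrC gtr0_norm// subr_gt0.
Qed.

Lemma near_right0P P : (\forall h \near 0^'+, P h) <->
  exists2 d, 0 < d & forall h, 0 < h < d -> P h.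
Proof.
by rewrite near_at_rightP; split=> -[d d0 dP]; exists d => // h /dP; rewrite add0r.
Qed.

Lemma near_at_right_shift (a : R) P :
  (\forall t \near a^'+, P t) <-> (\forall h \near 0^'+, P (a + h)).
Proof. by rewrite near_at_rightP near_right0P. Qed.

Lemma near_right0M (r : R) P : 0 < r ->
  (\forall h \near 0^'+, P h) -> (\forall h \near 0^'+, P (r * h)).
Proof.
move=> r0 /near_right0P[d d0 dP]; apply/near_right0P; exists (d / r).
  by rewrite divr_gt0.
move=> h /andP[h0 hd]; apply: dP; rewrite mulr_gt0//= mulrC.
by rewrite -ltr_pdivlMr.
Qed.

Lemma near_right0_scale_le (r l : R) : 0 <= r -> 0 < l ->
  \forall t \near 0^'+, 0 <= r * t <= l.
Proof.
move=> r0 l0; apply/near_right0P; exists (l / (r + 1)).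
  by rewrite divr_gt0// ltr_wpDl.
move=> t /andP[t0]; rewrite ltr_pdivlMr ?ltr_wpDl// => lt.
by apply/andP; split; nra.
Qed.

Lemma near_right0_ltr (d : R) : 0 < d -> \forall h \near 0^'+, 0 < h < d.
Proof. by move=> d0; apply/near_right0P; exists d. Qed.

Lemma acos_le : {in `[(-1 : R), 1] &, forall a b, a <= b -> acos b <= acos a}.
Proof.
move=> a b aI bI ab; rewrite leNgt; apply/negP => lt.
have a1 := acos_def aI; have b1 := acos_def bI.
have := ltr_cos a1.1 b1.1; rewrite a1.2 b1.2 lt ltNge ab.
by [].
Qed.

Lemma ler_cos (a b : R) : 0 <= a -> a <= b -> b <= pi -> cos b <= cos a.
Proof.
move=> a0 ab bpi; rewrite leNgt ltr_cos ?in_itv/= ?a0 ?bpi ?(le_trans ab)//.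
  by rewrite -leNgt.
by rewrite (le_trans a0).
Qed.

End RealLine.

Section Angle.
Context {R : realType} {X : metricType R} (hX : @CAT0 R X).
Context {x : X}.
Implicit Types (g h k : geodesic_from x) (r s t e : R).

Lemma geodesic_from_mdist0 g s : 0 <= s <= glen g -> mdist x (g s) = s.
Proof. by move=> /(mdist_isometric_on0 (@gcurve_iso _ _ _ g)); rewrite gcurve0. Qed.

Lemma geodesic_from_geodesic g s : 0 <= s <= glen g -> geodesic x (g s) g.
Proof. by move=> /(isometric_on_geodesic (@gcurve_iso _ _ _ g)); rewrite gcurve0. Qed.

(** The cosine of the comparison angle at [x] of the points [g s] and [h t]. *)
Definition comparison_cos g h s t :=
  (s ^+ 2 + t ^+ 2 - mdist (g s) (h t) ^+ 2) / (2 * s * t).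

Lemma comparison_angle_geodesic g h s t :
  0 <= s <= glen g -> 0 <= t <= glen h ->
  comparison_angle x (g s) (h t) = acos (comparison_cos g h s t).
Proof. by move=> hs ht; rewrite /comparison_angle !geodesic_from_mdist0. Qed.

Lemma comparison_cos_itv g h s t : 0 < s <= glen g -> 0 < t <= glen h ->
  comparison_cos g h s t \in `[(-1), 1].
Proof.
move=> /andP[s0 sl] /andP[t0 tl]; rewrite in_itv/=.
have := ler_mdist x (g s) (h t); have := metric_triangle (g s) x (h t).
rewrite (metric_sym (g s) x) !geodesic_from_mdist0 ?(ltW s0) ?(ltW t0)//.
have := mdist_ge0 (g s) (h t); rewrite /comparison_cos.
set d := mdist _ _ => d0 dst; rewrite ler_norml => /andP[std tsd].
have st0 : 0 < 2 * s * t by rewrite !mulr_gt0.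
by rewrite ler_pdivlMr// ler_pdivrMr//; apply/andP; split; nra.
Qed.

(** Comparison angles shrink with the triangle.  Hence the Alexandrov angle is
    their infimum, and the limit that defines it exists. *)
Lemma comparison_cos_mono g h s t s' t' :
  0 < s -> s <= s' -> s' <= glen g -> 0 < t -> t <= t' -> t' <= glen h ->
  comparison_cos g h s' t' <= comparison_cos g h s t.
Proof.
move=> s0 ss' s'l t0 tt' t'l.
have s'0 : 0 < s' := lt_le_trans s0 ss'; have t'0 : 0 < t' := lt_le_trans t0 tt'.
have s'I : 0 <= s' <= glen g by rewrite (ltW s'0).
have t'I : 0 <= t' <= glen h by rewrite (ltW t'0).
have xs : x != g s' by rewrite -mdist_gt0 geodesic_from_mdist0.
have xt : x != h t' by rewrite -mdist_gt0 geodesic_from_mdist0.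
have := CAT0_law_of_cosines hX xs xt (geodesic_from_geodesic s'I)
  (geodesic_from_geodesic t'I).
rewrite !geodesic_from_mdist0// => /(_ s t).
rewrite (ltW s0) ss' (ltW t0) tt' => /(_ erefl erefl) le.
rewrite /comparison_cos ler_pdivlMr ?mulr_gt0//.
set k := (X in X * _).
have kE : (s' ^+ 2 + t' ^+ 2 - mdist (g s') (h t') ^+ 2) / (s' * t') = 2 * k.
  by rewrite /k; field; rewrite !gt_eqF.
by move: le; rewrite kE; lra.
Qed.

Let angle_values g h := [set acos (comparison_cos g h st.1 st.2) | st in
  [set st : R * R | 0 < st.1 <= glen g /\ 0 < st.2 <= glen h]].

Let angle_values_nonempty g h : angle_values g h !=set0.
Proof.
exists (acos (comparison_cos g h (glen g) (glen h))), (glen g, glen h) => //=.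
by rewrite !lexx !glen_gt0.
Qed.

Let angle_values_lbound g h : lbound (angle_values g h) 0.
Proof. by move=> _ [st [ls lt] <-]; exact/acos_ge0/comparison_cos_itv. Qed.

Let has_inf_angle_values g h : has_inf (angle_values g h).
Proof.
by split; [exact: angle_values_nonempty|exists 0; exact: angle_values_lbound].
Qed.

Let angle_values_near g h e : 0 < e -> exists2 d, 0 < d &
  forall s t, 0 < s < d -> 0 < t < d ->
   [/\ 0 < s <= glen g, 0 < t <= glen h &
    inf (angle_values g h) <= acos (comparison_cos g h s t)
      < inf (angle_values g h) + e].
Proof.
move=> e0; have [_ [[s0 t0]/= [ls lt] <-] lte] :=
  inf_adherent e0 (has_inf_angle_values g h).
have [s00 s0l] := andP ls; have [t00 t0l] := andP lt.
exists (Num.min s0 t0); first by rewrite lt_min s00.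
move=> s t; rewrite !lt_min => /andP[sp /andP[ss _]] /andP[tp /andP[_ tt]].
have sI : 0 < s <= glen g by rewrite sp (le_trans (ltW ss)).
have tI : 0 < t <= glen h by rewrite tp (le_trans (ltW tt)).
split=> //; apply/andP; split.
  by apply: (ge_inf (has_inf_angle_values g h).2); exists (s, t).
apply: le_lt_trans lte; apply: acos_le; rewrite ?comparison_cos_itv//.
by apply: comparison_cos_mono => //; rewrite ltW.
Qed.

Let angle_inf g h : angle g h = inf (angle_values g h).
Proof.
apply: cvg_lim; first exact: norm_hausdorff.
apply/cvgrPdist_lt => e /(angle_values_near g h)[d d0 dP].
exists ([set s | 0 < s < d], [set s | 0 < s < d]) => /=.
  by split; exact: near_right0_ltr.
move=> [s t]/= [/dP sd /sd[/andP[s0 sl] /andP[t0 tl]]].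
rewrite comparison_angle_geodesic ?(ltW s0) ?(ltW t0)// => /andP[le lt].
by rewrite distrC ger0_norm ?subr_ge0// ltrBlDl.
Qed.

Lemma angle_itv g h : 0 <= angle g h <= pi.
Proof.
rewrite angle_inf; apply/andP; split.
  exact: lb_le_inf (@angle_values_lbound g h).
have lg : 0 < glen g <= glen g by rewrite glen_gt0 lexx.
have lh : 0 < glen h <= glen h by rewrite glen_gt0 lexx.
apply: le_trans (acos_lepi (comparison_cos_itv lg lh)).
by apply: (ge_inf (has_inf_angle_values g h).2); exists (glen g, glen h).
Qed.

Lemma comparison_cos_le_angle g h s t :
  0 < s <= glen g -> 0 < t <= glen h -> comparison_cos g h s t <= cos (angle g h).
Proof.
move=> ls lt; have I := comparison_cos_itv ls lt.
rewrite -[leLHS](acosK I); have /andP[a0 _] := angle_itv g h.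
apply: ler_cos => //; last exact: acos_lepi.
by rewrite angle_inf; apply: (ge_inf (has_inf_angle_values g h).2); exists (s, t).
Qed.

Lemma comparison_cos_near_angle g h e : 0 < e ->
  exists2 d, 0 < d & forall s t, 0 < s < d -> 0 < t < d ->
    cos (angle g h) - e <= comparison_cos g h s t.
Proof.
move=> e0; have /cvgrPdist_lt/(_ e e0)/nbhs_ballP[n /= n0 nP] :=
  @continuous_cos R (angle g h).
have [d d0 dP] := angle_values_near g h n0; exists d => // s t sd td.
have [ls lt /andP[lo hi]] := dP s t sd td.
rewrite -[leRHS](acosK (comparison_cos_itv ls lt)) lerBlDl -lerBlDr.
apply: le_trans (ler_norm _) _; apply/ltW/nP.
rewrite /ball/= angle_inf distrC ger0_norm ?subr_ge0// ltrBlDl.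
exact: hi.
Qed.

(** An Alexandrov angle bounds distances from below at every scale, because it
    is at most every comparison angle; from above it bounds them only
    asymptotically, along two given geodesics (next lemma). *)
Lemma angle_mdist_ge g h s t : 0 <= s <= glen g -> 0 <= t <= glen h ->
  s ^+ 2 + t ^+ 2 - 2 * s * t * cos (angle g h) <= mdist (g s) (h t) ^+ 2.
Proof.
move=> /[dup] sI /andP[s0 sl] /[dup] tI /andP[t0 tl].
have [->|sN0] := eqVneq s 0.
  by rewrite gcurve0 geodesic_from_mdist0// expr0n/=; lra.
have [->|tN0] := eqVneq t 0.
  by rewrite gcurve0 metric_sym geodesic_from_mdist0// expr0n/=; lra.
have sp : 0 < s by rewrite lt_def sN0.
have tp : 0 < t by rewrite lt_def tN0.
have : comparison_cos g h s t <= cos (angle g h).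
  by apply: comparison_cos_le_angle; apply/andP; split.
rewrite /comparison_cos ler_pdivrMr ?mulr_gt0//; lra.
Qed.

Lemma angle_mdist_le g h r s e : 0 <= r -> 0 <= s -> 0 < e ->
  \forall t \near 0^'+, mdist (g (r * t)) (h (s * t)) ^+ 2 <=
    t ^+ 2 * (r ^+ 2 + s ^+ 2 - 2 * r * s * (cos (angle g h) - e)).
Proof.
move=> r0 s0 e0.
have lg := near_right0_scale_le r0 (glen_gt0 g).
have lh := near_right0_scale_le s0 (glen_gt0 h).
have [->|rN0] := eqVneq r 0.
  near=> t; rewrite mul0r gcurve0 geodesic_from_mdist0; last by near: t.
  by rewrite expr0n/= le_eqVlt; apply/orP; left; apply/eqP; ring.
have [->|sN0] := eqVneq s 0.
  near=> t; rewrite mul0r gcurve0 metric_sym geodesic_from_mdist0; last by near: t.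
  by rewrite expr0n/= le_eqVlt; apply/orP; left; apply/eqP; ring.
have rp : 0 < r by rewrite lt_def rN0.
have sp : 0 < s by rewrite lt_def sN0.
have [d d0 dP] := comparison_cos_near_angle g h e0.
have near_r := near_right0M rp (near_right0_ltr d0).
have near_s := near_right0M sp (near_right0_ltr d0).
near=> t.
have rt : 0 < r * t < d by near: t.
have st : 0 < s * t < d by near: t.
have := dP _ _ rt st; have [rt0 _] := andP rt; have [st0 _] := andP st.
by rewrite /comparison_cos ler_pdivlMr ?mulr_gt0//; lra.
Unshelve. all: by end_near. Qed.

End Angle.

(** * The triangle inequality for angles and for intrinsic distances *)

Section AngleTriangle.
Context {R : realType} {X : metricType R} (hX : @CAT0 R X).
Context {x : X}.
Implicit Types (g h k : geodesic_from x).

(** The bound on squared distances in usable form: [D] is any upper bound of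
    the distance, in the Euclidean plane, between points at distances [r] and
    [s] from the vertex on rays making the angle [angle g h]. *)
Lemma angle_mdist_near g h (r s D eta : R) : 0 <= r -> 0 <= s -> 0 <= D ->
  r ^+ 2 + s ^+ 2 - 2 * r * s * cos (angle g h) <= D ^+ 2 -> 0 < eta ->
  \forall t \near 0^'+, mdist (g (r * t)) (h (s * t)) <= t * (D + eta).
Proof.
move=> r0 s0 D0 le eta0.
have rs0 : 0 <= r * s by rewrite mulr_ge0.
pose e := eta ^+ 2 / (2 * (r * s) + 1).
have den0 : 0 < 2 * (r * s) + 1 by lra.
have e0 : 0 < e by rewrite divr_gt0// exprn_gt0.
have eE : e * (2 * (r * s) + 1) = eta ^+ 2 by rewrite divfK// gt_eqF.
have near_le := angle_mdist_le hX g h r0 s0 e0.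
near=> t.
have t0 : 0 < t by near: t; exact: nbhs_right_gt.
have D1 : 0 <= t * (D + eta) by rewrite mulr_ge0// ?addr_ge0// ltW.
rewrite -ler_sqr ?nnegrE ?mdist_ge0//.
apply: (@le_trans _ _ (t ^+ 2 * (r ^+ 2 + s ^+ 2 - 2 * r * s * (cos (angle g h) - e)))).
  by near: t.
rewrite exprMn ler_wpM2l ?sqr_ge0//.
have : 0 <= D * eta by rewrite mulr_ge0// ltW.
by nra.
Unshelve. all: by end_near. Qed.

(** Draw the three directions as rays in the plane, with [h] between [g] and
    [k], at angles [a] and [b] from them.  When [a + b < pi], the segment
    joining the points at distance 1 on the outer rays meets the middle ray
    at distance [p].  The triangle inequality of [X] through [h (p t)] then
    bounds the distance of [g t] and [k t] by the length of that segment,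
    which is [2 sin ((a + b) / 2)]. *)
Lemma angle_triangle g h k : angle g k <= angle g h + angle h k.
Proof.
have := angle_itv hX g h; have := angle_itv hX h k; have := angle_itv hX g k.
have := angle_mdist_near (g := g) (h := h).
have := angle_mdist_near (g := h) (h := k).
have := angle_mdist_ge hX (g := g) (h := k).
set a := angle g h; set b := angle h k; set c := angle g k.
move=> ge_gk near_hk near_gh /andP[c0 cpi] /andP[b0 bpi] /andP[a0 api].
have [?|abpi] := leP pi (a + b); first exact: le_trans cpi _.
pose m := (a + b) / 2; pose e := (a - b) / 2.
have aE : a = m + e by rewrite /m /e; field.
have bE : b = m - e by rewrite /m /e; field.
have ce0 : 0 < cos e by apply: cos_gt0_pihalf; rewrite /e; lra.
have cm0 : 0 < cos m by apply: cos_gt0_pihalf; rewrite /m; lra.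
have ceN0 : cos e != 0 by rewrite gt_eqF.
pose p := cos m / cos e.
have p0 : 0 < p by rewrite divr_gt0.
have sa0 : 0 <= sin a by apply: sin_ge0_pi; rewrite a0.
have sb0 : 0 <= sin b by apply: sin_ge0_pi; rewrite b0.
have d1 : 1 ^+ 2 + p ^+ 2 - 2 * 1 * p * cos a <= (sin a / cos e) ^+ 2.
  rewrite expr1n mulr1 le_eqVlt; apply/orP; left; apply/eqP.
  rewrite aE sinD cosD /p; apply/eqP; rewrite -subr_eq0; apply/eqP.
  transitivity ((cos e ^+ 2 + cos m ^+ 2 * sin e ^+ 2
     - cos e ^+ 2 * sin m ^+ 2 - cos m ^+ 2 * sin e ^+ 2 * 2 + cos m ^+ 2 - 2 * cos m ^+ 2 * cos e ^+ 2) / cos e ^+ 2).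
    by field.
  by rewrite !sin2cos2; field.
have d2 : p ^+ 2 + 1 ^+ 2 - 2 * p * 1 * cos b <= (sin b / cos e) ^+ 2.
  rewrite expr1n mulr1 le_eqVlt; apply/orP; left; apply/eqP.
  rewrite bE sinB cosB /p; apply/eqP; rewrite -subr_eq0; apply/eqP.
  transitivity ((cos e ^+ 2 + cos m ^+ 2 * sin e ^+ 2
     - cos e ^+ 2 * sin m ^+ 2 - cos m ^+ 2 * sin e ^+ 2 * 2 + cos m ^+ 2 - 2 * cos m ^+ 2 * cos e ^+ 2) / cos e ^+ 2).
    by field.
  by rewrite !sin2cos2; field.
(* the two parts of the segment, [sin a / cos e] and [sin b / cos e] *)
have d12 : sin a / cos e + sin b / cos e = 2 * sin m.
  by rewrite aE bE sinB sinD; field.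
have d1p : 0 <= sin a / cos e by rewrite divr_ge0// ltW.
have d2p : 0 <= sin b / cos e by rewrite divr_ge0// ltW.
have sc0 : 0 <= sin (c / 2) by apply: sin_ge0_pi; lra.
have cE : 2 - 2 * cos c = (2 * sin (c / 2)) ^+ 2.
  have -> : cos c = cos (c / 2 + c / 2) by congr cos; field.
  by rewrite cosD -!expr2 cos2sin2; ring.
have le_sin : sin (c / 2) <= sin m.
  apply/ler_addgt0Pr => eta eta0.
  have near1 := near_gh 1 p _ eta ler01 (ltW p0) d1p d1 eta0.
  have near2 := near_hk p 1 _ eta (ltW p0) ler01 d2p d2 eta0.
  have min0 : 0 < Num.min (glen g) (glen k) by rewrite lt_min !glen_gt0.
  have : \forall t \near 0^'+, [/\ mdist (g (1 * t)) (h (p * t)) <= t * (sin a / cos e + eta),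
     mdist (h (p * t)) (k (1 * t)) <= t * (sin b / cos e + eta) &
     0 < t < Num.min (glen g) (glen k)].
    by near=> t; split; near: t => //; exact: near_right0_ltr.
  move=> /near_right0P[d d0 /(_ (d / 2))].
  set t := d / 2; move=> []; first by rewrite /t; lra.
  clearbody t; move=> le1 le2 /andP[t0]; rewrite lt_min => /andP[tg tk]; rewrite !mul1r in le1 le2.
  have := ge_gk t t; rewrite !(ltW t0) (ltW tg) (ltW tk) => /(_ erefl erefl).
  have := metric_triangle (g t) (h (p * t)) (k t).
  have -> : t ^+ 2 + t ^+ 2 - 2 * t * t * cos c = (t * (2 * sin (c / 2))) ^+ 2.
    by rewrite exprMn -cE; ring.
  rewrite ler_sqr ?nnegrE ?mdist_ge0 ?mulr_ge0 ?(ltW t0)// => tri le.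
  rewrite -(ler_pM2l (_ : 0 < t * 2)) ?mulr_gt0//.
  have : t * (sin a / cos e + sin b / cos e) = t * (2 * sin m) by rewrite d12.
  by lra.
rewrite leNgt; apply/negP => abc; move: le_sin; rewrite leNgt => /negP; apply.
by rewrite ltr_sin ?in_itv/= /m; lra.
Unshelve. all: by end_near. Qed.

Lemma angle_eq0 g h : gcurve g = gcurve h -> angle g h = 0.
Proof.
move=> gh; have /andP[a0 api] := angle_itv hX g h.
apply/eqP; rewrite eq_le a0 andbT leNgt; apply/negP => ap.
have := ltr_cos (_ : 0 \in `[0, pi]) (_ : angle g h \in `[0, pi]).
rewrite !in_itv/= a0 api lexx pi_ge0 ap cos0 => /(_ erefl erefl).
apply/negP; rewrite -leNgt.
pose l := Num.min (glen g) (glen h).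
have l0 : 0 < l by rewrite lt_min !glen_gt0.
have lg : 0 < l <= glen g by rewrite l0 ge_min lexx.
have lh : 0 < l <= glen h by rewrite l0 ge_min lexx orbT.
have := comparison_cos_le_angle hX lg lh; apply: le_trans.
rewrite /comparison_cos gh mdistxx le_eqVlt; apply/orP; left; apply/eqP.
by field; rewrite gt_eqF.
Qed.

End AngleTriangle.

Section Polyline.
Context {R : realType} {T : Type} (dist : T -> T -> R) (c : R -> T).

Fixpoint polyline_length (a : R) (s : seq R) : R :=
  if s is u :: s' then dist (c a) (c u) + polyline_length u s' else 0.

Lemma polyline_lengthE a b s :
  \sum_(i < size s) dist (c (nth b (a :: s) i)) (c (nth b (a :: s) i.+1)) =
  polyline_length a s.
Proof.
elim: s a => [|u s IH] a; first by rewrite big_ord0.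
by rewrite big_ord_recl /= -IH.
Qed.

Lemma polyline_le_curve_length a b s : itv_partition a b s ->
  ((polyline_length a s)%:E <= curve_length dist c a b)%E.
Proof.
by move=> sP; apply: ereal_sup_ubound; exists s => //; rewrite polyline_lengthE.
Qed.

Lemma curve_length_le a b K :
  (forall s, itv_partition a b s -> ((polyline_length a s)%:E <= K)%E) ->
  (curve_length dist c a b <= K)%E.
Proof.
by move=> H; apply: ge_ereal_sup => _ [s sP <-]; rewrite polyline_lengthE; exact: H.
Qed.

End Polyline.

Section Concatenation.
Context {R : realType} {T : Type} (dist : T -> T -> R).
Context (dist_triangle : forall x y z, dist x z <= dist x y + dist y z).
Context (c1 c2 : R -> T) (c12 : c1 1 = c2 0).

Definition concat_path (u : R) : T := if u <= 2^-1 then c1 (2 * u) else c2 (2 * u - 1).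

Lemma concat_pathl u : u <= 2^-1 -> concat_path u = c1 (2 * u).
Proof. by rewrite /concat_path => ->. Qed.

Lemma concat_pathr u : 2^-1 <= u -> concat_path u = c2 (2 * u - 1).
Proof.
rewrite /concat_path le_eqVlt => /predU1P[<-|].
  by rewrite lexx divff// subrr.
by rewrite ltNge => /negbTE ->.
Qed.

Lemma polyline_concatr u s : 2^-1 <= u -> path <%O u s ->
  polyline_length dist concat_path u s =
  polyline_length dist c2 (2 * u - 1) [seq 2 * v - 1 | v <- s].
Proof.
elim: s u => [//|v s IH] u hu /= /andP[uv sP].
have hv : 2^-1 <= v by rewrite (le_trans hu)// ltW.
by rewrite IH// !concat_pathr.
Qed.

Lemma itv_partition_double (u : R) s : itv_partition u 1 s ->
  itv_partition (2 * u - 1) 1 [seq 2 * v - 1 | v <- s].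
Proof.
elim: s u => [|v s IH] u; rewrite /itv_partition /=.
  by move=> [_ /eqP ->]; split=> //; apply/eqP; ring.
move=> [/andP[uv sP] sl]; have [ih1 ih2] := IH v (conj sP sl).
by split=> //; rewrite ih1 andbT; lra.
Qed.

(** The edge of a polyline that straddles the junction of the two paths is cut
    there, which does not shorten the polyline. *)
Lemma polyline_concat u s : u < 2^-1 -> itv_partition u 1 s ->
  exists s1 s2, [/\ itv_partition (2 * u) 1 s1, itv_partition 0 1 s2 &
    polyline_length dist concat_path u s <=
    polyline_length dist c1 (2 * u) s1 + polyline_length dist c2 0 s2].
Proof.
elim: s u => [|v s IH] u hu.
  by move=> /itv_partition_nil u1; move: hu; rewrite u1; lra.
move=> /[dup] /itv_partition_cons sP [/= /andP[uv vs] _].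
have [hv|hv] := ltP v 2^-1.
  have [s1 [s2 [[P1 P1'] P2 le]]] := IH v hv sP.
  exists (2 * v :: s1), s2; split=> //; first by split=> //=; rewrite P1 andbT; lra.
  by rewrite (concat_pathl (ltW hu)) (concat_pathl (ltW hv)) /=; lra.
have part := itv_partition_double sP.
have p1 : itv_partition (2 * u) 1 [:: 1] by apply: itv_partition1; lra.
rewrite polyline_concatr// (concat_pathl (ltW hu)) (concat_pathr hv).
have [vE|vN] := eqVneq v 2^-1.
  have v0 : 2 * v - 1 = 0 by rewrite vE; lra.
  exists [:: 1], [seq 2 * w - 1 | w <- s]; rewrite -v0; split=> //=.
  by rewrite c12 v0; lra.
exists [:: 1], (2 * v - 1 :: [seq 2 * w - 1 | w <- s]); split=> //.
  have [q1 q2] := part; split=> //=; rewrite q1 andbT.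
  have : 2^-1 < v by rewrite lt_def vN.
  by lra.
by rewrite /= c12; have := dist_triangle (c1 (2 * u)) (c2 0) (c2 (2 * v - 1)); lra.
Qed.

Lemma curve_length_concat :
  (curve_length dist concat_path 0 1 <=
   curve_length dist c1 0 1 + curve_length dist c2 0 1)%E.
Proof.
apply: curve_length_le => s sP.
have [|s1 [s2 [P1 P2 le]]] := polyline_concat _ sP; first by rewrite invr_gt0.
rewrite mulr0 in P1 le.
apply: (@le_trans _ _ (polyline_length dist c1 0 s1 + polyline_length dist c2 0 s2)%:E).
  by rewrite lee_fin.
by rewrite EFinD leeD// polyline_le_curve_length.
Qed.

End Concatenation.

Section IntrinsicDist.
Context {R : realType} {X : metricType R} (hX : @CAT0 R X).
Context {x : X}.
Implicit Types (g h k : geodesic_from x) (c : R -> geodesic_from x).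

(** The partition of [[0, 1]] without inner points already gives the angle. *)
Lemma angle_le_intrinsic_dist g h : ((angle g h)%:E <= intrinsic_dist g h)%E.
Proof.
apply: le_ereal_inf_tmp => _ [c [<- <- _] <-].
have := polyline_le_curve_length (@angle _ _ x) c (itv_partition1 (@ltr01 R)).
by rewrite /= addr0.
Qed.

Lemma intrinsic_dist_ge0 g h : (0 <= intrinsic_dist g h)%E.
Proof.
apply: le_trans (angle_le_intrinsic_dist g h); rewrite lee_fin.
by case/andP: (angle_itv hX g h).
Qed.

(** Two geodesics with the same underlying curve may still differ by their
    lengths; a path that jumps from one to the other is continuous for the
    angle. *)
Lemma intrinsic_dist_eq0 g h : gcurve g = gcurve h -> intrinsic_dist g h = 0%E.
Proof.
move=> gh; apply/eqP; rewrite eq_le intrinsic_dist_ge0 andbT.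
pose c (u : R) := if u < 1 then g else h.
have cE u : gcurve (c u) = gcurve g by rewrite /c; case: ifP.
have c_angle u v : angle (c u) (c v) = 0 by apply: angle_eq0; rewrite ?cE.
apply: (@le_trans _ _ (curve_length (@angle _ _ x) c 0 1)).
  apply: ereal_inf_lbound; exists c => //; split.
  - by rewrite /c ltr01.
  - by rewrite /c ltxx.
  - by move=> s _; under eq_fun do rewrite c_angle; exact: cvg_cst.
apply: curve_length_le => s _.
suff -> a : polyline_length (@angle _ _ x) c a s = 0 by [].
by elim: s a => [//|u s IH] a /=; rewrite IH c_angle addr0.
Qed.

Let angle_continuous_at c s := forall e : R, 0 < e -> exists2 d, 0 < d &
  forall u, 0 <= u <= 1 -> `|u - s| < d -> angle (c u) (c s) < e.

Let angle_continuousP c s :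
  angle (c u) (c s) @[u --> within `[0, 1] (nbhs s)] --> (0 : R) <->
  angle_continuous_at c s.
Proof.
have a0 u : 0 <= angle (c u) (c s) by case/andP: (angle_itv hX (c u) (c s)).
split.
  move=> /cvgrPdist_lt cvg e /cvg /nbhs_ballP[d /= d0 dP]; exists d => // u uI us.
  have := dP u; rewrite /ball/= distrC => /(_ us uI).
  by rewrite sub0r normrN ger0_norm.
move=> C; apply/cvgrPdist_lt => e /C [d d0 dP]; apply/nbhs_ballP; exists d => //= u.
rewrite /ball/= distrC => us uI; rewrite sub0r normrN ger0_norm//.
exact: dP.
Qed.

Let angle_path_concat g h k c1 c2 : angle_path g h c1 -> angle_path h k c2 ->
  angle_path g k (concat_path c1 c2).
Proof.
move=> [c10 c11 C1] [c20 c21 C2]; have c12 : c1 1 = c2 0 by rewrite c11 c20.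
split.
- by rewrite concat_pathl ?invr_ge0// mulr0.
- by rewrite concat_pathr// ?invf_le1 ?ler1n// mulr1 -{1}[2](@natrD R 1 1) addrK.
move=> s /andP[s0 s1]; apply/angle_continuousP => e e0.
have [hs|hs|hs] := ltgtP s 2^-1.
- have /angle_continuousP/(_ e e0)[d d0 dP] := C1 (2 * s) ltac:(lra).
  exists (Num.min (d / 2) (2^-1 - s)).
    by rewrite lt_min divr_gt0//= subr_gt0.
  move=> u /andP[u0 u1]; rewrite lt_min !ltr_norml => /andP[/andP[ud ud'] /andP[us us']].
  rewrite !concat_pathl; [|lra|lra].
  by apply: dP; [lra|rewrite ltr_norml; lra].
- have /angle_continuousP/(_ e e0)[d d0 dP] := C2 (2 * s - 1) ltac:(lra).
  exists (Num.min (d / 2) (s - 2^-1)).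
    by rewrite lt_min divr_gt0//= subr_gt0.
  move=> u /andP[u0 u1]; rewrite lt_min !ltr_norml => /andP[/andP[ud ud'] /andP[us us']].
  rewrite !concat_pathr//; [|lra|lra].
  by apply: dP; [lra|rewrite ltr_norml; lra].
- have /angle_continuousP/(_ e e0)[d d0 dP] := C1 (1) ltac:(lra).
  have /angle_continuousP/(_ e e0)[d' d'0 d'P] := C2 (0) ltac:(lra).
  exists (Num.min (d / 2) (d' / 2)); first by rewrite lt_min !divr_gt0.
  move=> u /andP[u0 u1]; rewrite hs lt_min !ltr_norml => /andP[/andP[ud ud'] /andP[us us']].
  have [hu|hu] := leP u 2^-1.
    rewrite !concat_pathl// divff//.
    by apply: dP; [lra|rewrite ltr_norml; lra].
  rewrite !concat_pathr ?(ltW hu)// divff// subrr.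
  by apply: d'P; [lra|rewrite ltr_norml; lra].
Qed.

Lemma intrinsic_dist_triangle g h k :
  (intrinsic_dist g k <= intrinsic_dist g h + intrinsic_dist h k)%E.
Proof.
have [->|gh] := eqVneq (intrinsic_dist g h) +oo%E.
  by rewrite addye ?leey// gt_eqF// (lt_le_trans _ (intrinsic_dist_ge0 h k)).
have [->|hk] := eqVneq (intrinsic_dist h k) +oo%E.
  by rewrite addey ?leey// gt_eqF// (lt_le_trans _ (intrinsic_dist_ge0 g h)).
have ghf : intrinsic_dist g h \is a fin_num.
  by rewrite ge0_fin_numE ?intrinsic_dist_ge0// ltey.
have hkf : intrinsic_dist h k \is a fin_num.
  by rewrite ge0_fin_numE ?intrinsic_dist_ge0// ltey.
apply/lee_addgt0Pr => e e0; have e20 : 0 < e / 2 by rewrite divr_gt0.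
have [_ [c1 P1 <-] le1] := lb_ereal_inf_adherent e20 ghf.
have [_ [c2 P2 <-] le2] := lb_ereal_inf_adherent e20 hkf.
apply: (@le_trans _ _ (curve_length (@angle _ _ x) (concat_path c1 c2) 0 1)).
  by apply: ereal_inf_lbound; exists (concat_path c1 c2) => //; exact: angle_path_concat P1 P2.
have c12 : c1 1 = c2 0 by case: P1 P2 => [_ -> _] [-> _ _].
apply: (le_trans (curve_length_concat (angle_triangle hX) _)) => //.
have -> : (e%:E = (e / 2)%:E + (e / 2)%:E)%E by rewrite -EFinD -splitr.
by rewrite addeACA leeD// ltW.
Qed.

End IntrinsicDist.

(** * Distances in the completed space of directions *)

Lemma cos_ge_near {R : realType} (c e : R) : 0 < e ->
  exists2 d, 0 < d & forall a, 0 <= a <= pi -> 0 <= c <= pi -> a < c + d ->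
    cos c - e <= cos a.
Proof.
move=> e0; have /cvgrPdist_lt/(_ e e0)/nbhs_ballP[d /= d0 dP] :=
  @continuous_cos R c.
exists d => // a /andP[a0 api] /andP[c0 cpi] acd.
have [ac|ca] := leP a c.
  by rewrite lerBlDr (le_trans (ler_cos a0 ac cpi))// lerDl ltW.
have := dP a; rewrite /ball/= distrC gtr0_norm ?subr_gt0// ltrBlDl => /(_ acd).
by rewrite ltr_norml; lra.
Qed.

Section SeqDist.
Context {R : realType} {X : metricType R} (hX : @CAT0 R X).
Context {x : X}.
Implicit Types (g h k : geodesic_from x) (xi eta : direction x).

(** The limit defining [seq_dist] exists: by the triangle inequality the
    sequence is either eventually infinite or Cauchy. *)
Lemma seq_dist_cvg xi eta :
  intrinsic_dist (xi n) (eta n) @[n --> \oo] --> seq_dist xi eta.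
Proof.
suff : cvg (intrinsic_dist (xi n) (eta n) @[n --> \oo]) by [].
have ge0 n := intrinsic_dist_ge0 hX (xi n) (eta n).
have quad e : 0 < e -> exists N, forall m n, (N <= m)%N -> (N <= n)%N ->
    (intrinsic_dist (xi m) (eta m) <= intrinsic_dist (xi n) (eta n) + e%:E)%E.
  move=> e0; have e20 : 0 < e / 2 by rewrite divr_gt0.
  have [N1 H1] := dseq_cauchy xi e20; have [N2 H2] := dseq_cauchy eta e20.
  exists (maxn N1 N2) => m n; rewrite !geq_max => /andP[m1 m2] /andP[n1 n2].
  apply: le_trans (intrinsic_dist_triangle hX _ (xi n) _) _.
  have -> : (intrinsic_dist (xi n) (eta n) + e%:E =
      (e / 2)%:E + (intrinsic_dist (xi n) (eta n) + (e / 2)%:E))%E.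
    by rewrite addeCA -EFinD -splitr.
  apply: leeD; first by apply/ltW; exact: H1.
  apply: le_trans (intrinsic_dist_triangle hX _ (eta n) _) _.
  by rewrite leeD2l//; apply/ltW; exact: H2.
have [N1 H1] := quad 1 ltr01.
have [inf|fin] := eqVneq (intrinsic_dist (xi N1) (eta N1)) +oo%E.
  apply/cvg_ex; exists +oo%E; apply: cvg_near_cst; exists N1 => // n /= nN.
  have := H1 N1 n (leqnn _) nN; rewrite inf.
  by case: (intrinsic_dist (xi n) (eta n)).
have fin_n n : (N1 <= n)%N -> intrinsic_dist (xi n) (eta n) \is a fin_num.
  move=> nN; rewrite ge0_fin_numE//; apply: le_lt_trans (H1 n N1 nN (leqnn _)) _.
  by rewrite lte_add_pinfty ?ltry// ltey.
pose u n := fine (intrinsic_dist (xi n) (eta n)).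
have : cvg (u @ \oo).
  apply: cauchy_cvg; apply/cauchy_exP => e e0.
  have e20 : 0 < e / 2 by rewrite divr_gt0.
  have [N2 H2] := quad _ e20; exists (u (maxn N1 N2)).
  exists (maxn N1 N2) => //= n nN; rewrite /ball/=.
  have le m p : (maxn N1 N2 <= m)%N -> (maxn N1 N2 <= p)%N -> u m <= u p + e / 2.
    rewrite !geq_max => /andP[m1 m2] /andP[p1 p2].
    by rewrite -lee_fin EFinD !fineK ?fin_n// H2.
  by rewrite ltr_norml; have := le _ _ (leqnn _) nN; have := le _ _ nN (leqnn _); lra.
move=> /cvg_ex[l ul]; apply/cvg_ex; exists l%:E; apply/fine_cvgP; split=> //.
by exists N1 => // n /= /fin_n.
Qed.

Lemma seq_dist_ge0 xi eta : (0 <= seq_dist xi eta)%E.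
Proof.
rewrite -(cvg_lim _ (@seq_dist_cvg xi eta))//; apply: lime_ge.
  by apply/cvg_ex; exists (seq_dist xi eta); exact: seq_dist_cvg.
by near=> n; exact: intrinsic_dist_ge0.
Unshelve. all: by end_near. Qed.

Lemma cone_angle_itv xi eta : 0 <= cone_angle xi eta <= pi.
Proof.
have := seq_dist_ge0 xi eta.
rewrite /cone_angle; case: (seq_dist xi eta) => [r||]//=; last first.
  by rewrite /Order.min/=; rewrite pi_ge0 lexx.
rewrite lee_fin -EFin_min /= => r0.
by rewrite le_min r0 pi_ge0 ge_min lexx orbT.
Qed.

Lemma cone_angle_le xi eta e : 0 <= e ->
  (\forall n \near \oo, (intrinsic_dist (xi n) (eta n) <= e%:E)%E) ->
  cone_angle xi eta <= e.
Proof.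
move=> e0 H; have : (seq_dist xi eta <= e%:E)%E.
  rewrite -(cvg_lim _ (@seq_dist_cvg xi eta))//; apply: lime_le => //.
  by apply/cvg_ex; exists (seq_dist xi eta); exact: seq_dist_cvg.
have := cone_angle_itv xi eta; rewrite /cone_angle.
case: (seq_dist xi eta) => [r||]//=.
  by rewrite lee_fin -EFin_min/= => _ re; rewrite ge_min re.
by rewrite min_l ?leNye.
Qed.

Lemma cone_anglexx xi : cone_angle xi xi = 0.
Proof.
apply/eqP; rewrite eq_le; have /andP[-> _] := cone_angle_itv xi xi.
rewrite andbT; apply: cone_angle_le => //; near=> n.
by rewrite intrinsic_dist_eq0.
Unshelve. all: by end_near. Qed.

(** An angle is at most the intrinsic distance, so that its cosine is at least
    that of the cone angle, up to the error of the approximation.  This is the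
    inequality from which upper bounds of distances in [X] follow. *)
Lemma cos_cone_angle_near xi eta e : 0 < e ->
  \forall n \near \oo, cos (cone_angle xi eta) - e <= cos (angle (xi n) (eta n)).
Proof.
move=> e0; have [d d0 dP] := cos_ge_near (cone_angle xi eta) e0.
suff : \forall n \near \oo, angle (xi n) (eta n) < cone_angle xi eta + d.
  by apply: filterS => n; apply: dP; [exact: angle_itv|exact: cone_angle_itv].
have [big|small] := leP pi%:E (seq_dist xi eta).
  near=> n; have /andP[_ /le_lt_trans] := angle_itv hX (xi n) (eta n); apply.
  by rewrite /cone_angle min_r// ltrDl.
have := seq_dist_ge0 xi eta; have := @seq_dist_cvg xi eta.
rewrite /cone_angle min_l ?(ltW small)//.
case: (seq_dist xi eta) small => [l||]// _.
move=> /fine_cvgP[fin /cvgrPdist_lt/(_ d d0) nl] _; near=> n.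
have : ((angle (xi n) (eta n))%:E <= intrinsic_dist (xi n) (eta n))%E.
  exact: angle_le_intrinsic_dist.
rewrite -(fineK (_ : intrinsic_dist (xi n) (eta n) \is a fin_num)); last by near: n.
rewrite lee_fin => /le_lt_trans; apply.
have : `|l - (fine \o (fun n => intrinsic_dist (xi n) (eta n))) n| < d by near: n.
by rewrite /= ltr_norml; lra.
Unshelve. all: by end_near. Qed.

Lemma intrinsic_distxx_cauchy g (e : R) : 0 < e -> exists N, forall m n,
  (N <= m)%N -> (N <= n)%N ->
  (intrinsic_dist ((fun _ : nat => g) m) ((fun _ : nat => g) n) < e%:E)%E.
Proof. by move=> e0; exists 0%N => m n _ _; rewrite intrinsic_dist_eq0. Qed.

Definition geodesic_direction g : direction x :=
  Direction (@intrinsic_distxx_cauchy g).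

Lemma cos_cone_angle_geodesic_near xi e : 0 < e ->
  \forall n \near \oo, 1 - e <= cos (cone_angle (geodesic_direction (xi n)) xi).
Proof.
move=> e0; have [d d0 dP] := cos_ge_near 0 e0.
have d20 : 0 < d / 2 by rewrite divr_gt0.
have [N H] := dseq_cauchy xi d20.
near=> n; rewrite -[X in X - e]cos0; apply: dP.
- exact: cone_angle_itv.
- by rewrite lexx pi_ge0.
rewrite add0r; apply: (@le_lt_trans _ _ (d / 2)); last lra.
apply: cone_angle_le; first by lra.
have nN : (N <= n)%N by near: n; exact: nbhs_infty_ge.
by near=> m; apply/ltW/H => //; near: m; exact: nbhs_infty_ge.
Unshelve. all: by end_near. Qed.

End SeqDist.

(** * Tangent vectors and rays *)

Section Cone.
Context {R : realType} {X : metricType R} (hX : @CAT0 R X).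
Context {x : X}.
Implicit Types (g h : geodesic_from x) (v w : tangent x) (e : R).

Lemma tnorm_ge0 v : 0 <= tnorm v. Proof. by case: v => [|xi r] /=. Qed.

Lemma tprod_le v w : tprod v w <= tnorm v * tnorm w.
Proof.
case: v w => [|xi r] [|eta s]; rewrite /= ?mul0r ?mulr0//.
by rewrite ler_piMr ?cos_le1// mulr_ge0.
Qed.

Lemma tprodxx v : tprod v v = tnorm v ^+ 2.
Proof. by case: v => [|xi r] /=; rewrite ?expr0n// cone_anglexx// cos0 mulr1. Qed.

Lemma cone_dist_ge0 v w : 0 <= cone_dist v w. Proof. exact: sqrtr_ge0. Qed.

Lemma cone_dist_sqr v w :
  cone_dist v w ^+ 2 = tnorm v ^+ 2 + tnorm w ^+ 2 - 2 * tprod v w.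
Proof.
rewrite sqr_sqrtr//; have := tprod_le v w.
by have := sqr_ge0 (tnorm v - tnorm w); lra.
Qed.

Definition geodesic_vector g (r : {nonneg R}) : tangent x :=
  Tvec (geodesic_direction hX g) r.

Lemma tprod_geodesic_vector v g r :
  tprod v (geodesic_vector g r) = r%:num * tprod v (geodesic_vector g 1%:nng).
Proof. by case: v => [|xi s] /=; rewrite ?mulr0//; ring. Qed.

(** A direction is only a limit of geodesics; this is the geodesic, run at
    speed [tnorm v], that starts in the [n]-th approximation of the direction
    of [v]. *)
Definition ray v (n : nat) (t : R) : X := if v is Tvec xi r then xi n (r%:num * t) else x.

Lemma ray_mdist v n : \forall t \near 0^'+, mdist x (ray v n t) = tnorm v * t.
Proof.
case: v => [|xi r] /=; first by near=> t; rewrite mdistxx mul0r.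
near=> t; apply: geodesic_from_mdist0; near: t; apply: near_right0_scale_le => //.
exact: glen_gt0.
Unshelve. all: by end_near. Qed.

(** Rays of [X] separate at most at the speed given by the cone metric.  The
    order of the quantifiers matters: the time interval depends on [n]. *)
Lemma ray_mdist_near v w eta : 0 < eta -> \forall n \near \oo, \forall t \near 0^'+,
  mdist (ray v n t) (ray w n t) <= t * (cone_dist v w + eta).
Proof.
move=> eta0; have e20 : 0 < eta / 2 by rewrite divr_gt0.
have [c0 cE] := (cone_dist_ge0 v w, cone_dist_sqr v w).
case: v w c0 cE => [|xi r] w c0 cE.
  near=> n; near=> t; have t0 : 0 < t by near: t; exact: nbhs_right_gt.
  have -> : mdist (ray (Vertex x) n t) (ray w n t) = tnorm w * t.
    by near: t; exact: ray_mdist.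
  rewrite mulrC ler_pM2l//; move: cE; rewrite /= expr0n/= mulr0 subr0 add0r.
  by move=> /eqP; rewrite eqrXn2 ?tnorm_ge0// => /eqP ->; lra.
case: w c0 cE => [|zeta s] c0 cE.
  near=> n; near=> t; have t0 : 0 < t by near: t; exact: nbhs_right_gt.
  rewrite metric_sym; have -> : mdist (ray (Vertex x) n t) (ray (Tvec xi r) n t) = r%:num * t.
    by near: t; exact: ray_mdist.
  rewrite mulrC ler_pM2l//; move: cE; rewrite /= expr0n/= mulr0 subr0 addr0.
  by move=> /eqP; rewrite eqrXn2// => /eqP ->; lra.
have r0 : 0 <= r%:num by [].
have s0 : 0 <= s%:num by [].
have rs0 : 0 <= r%:num * s%:num by rewrite mulr_ge0.
pose e := (eta / 2) ^+ 2 / (2 * (r%:num * s%:num) + 1).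
have den0 : 0 < 2 * (r%:num * s%:num) + 1 by lra.
have e0 : 0 < e by rewrite divr_gt0// exprn_gt0.
have eE : e * (2 * (r%:num * s%:num) + 1) = (eta / 2) ^+ 2 by rewrite divfK// gt_eqF.
have near_cos := cos_cone_angle_near hX xi zeta e0.
near=> n.
have le : cos (cone_angle xi zeta) - e <= cos (angle (xi n) (zeta n)) by near: n.
have D0 : 0 <= cone_dist (Tvec xi r) (Tvec zeta s) + eta / 2 by lra.
rewrite [eta in _ + eta]splitr addrA /ray; apply: angle_mdist_near => //.
move: cE c0 D0; rewrite /=; set D := cone_dist _ _ => cE c0 D0.
have : r%:num * s%:num * (cos (cone_angle xi zeta) - e) <=
       r%:num * s%:num * cos (angle (xi n) (zeta n)) by rewrite ler_wpM2l.
have : 0 <= D * (eta / 2) by rewrite mulr_ge0// ltW.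
by nra.
Unshelve. all: by end_near. Qed.

(** The upper half of the first variation formula.  The ray is compared with
    [g] run at a large speed [k]: the cone distance of the two vectors is
    [k - tprod v g + O(1 / k)], and running along [g] gains [k t]. *)
Lemma ray_mdist_geodesic v g (l eta : R) : 0 < l <= glen g -> 0 < eta ->
  \forall n \near \oo, \forall t \near 0^'+,
    mdist (ray v n t) (g l) <= l + t * (eta - tprod v (geodesic_vector g 1%:nng)).
Proof.
move=> /andP[l0 lg] eta0; have e20 : 0 < eta / 2 by rewrite divr_gt0.
set P := tprod _ _; set r := tnorm v; have r0 : 0 <= r := tnorm_ge0 v.
have Pr : P <= r by apply: le_trans (tprod_le _ _) _; rewrite /= mulr1.
(* large enough for [r ^+ 2 / (2 * k) <= eta / 2] and for [P <= k] *)
pose k := r ^+ 2 / eta + r + 1.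
have q0 : 0 <= r ^+ 2 / eta by rewrite divr_ge0 ?sqr_ge0// ltW.
have k0 : 0 <= k by rewrite /k; lra.
have near_k := ray_mdist_near v (geodesic_vector g (NngNum k0)) e20.
have kp : 0 < k by rewrite /k; lra.
have rk : r ^+ 2 / (2 * k) <= eta / 2.
  rewrite ler_pdivrMr ?mulr_gt0//.
  have : r ^+ 2 / eta * eta = r ^+ 2 by rewrite divfK// gt_eqF.
  by rewrite /k; nra.
have rk0 : 0 <= r ^+ 2 / (2 * k) by rewrite divr_ge0 ?sqr_ge0// mulr_ge0.
have dist_le : cone_dist v (geodesic_vector g (NngNum k0)) <= k - P + r ^+ 2 / (2 * k).
  rewrite -ler_sqr ?nnegrE ?cone_dist_ge0 ?cone_dist_sqr//; last by rewrite /k; lra.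
  rewrite tprod_geodesic_vector /= -/P -/r -subr_ge0.
  rewrite (_ : _ - _ = (P - r ^+ 2 / (2 * k)) ^+ 2) ?sqr_ge0//.
  by field; rewrite gt_eqF.
apply: filterS near_k => n; rewrite /ray /= => near_n.
near=> t.
have t0 : 0 < t by near: t; exact: nbhs_right_gt.
have /andP[kt0 ktl] : 0 <= k * t <= l by near: t; exact: near_right0_scale_le.
have dE : mdist (g (k * t)) (g l) = l - k * t.
  rewrite (@gcurve_iso _ _ _ g) ?kt0 ?(le_trans ktl)// ?(ltW l0)//.
  by rewrite distrC ger0_norm// subr_ge0.
have le1 : mdist (ray v n t) (g (k * t)) <=
    t * (cone_dist v (geodesic_vector g (NngNum k0)) + eta / 2) by near: t.
apply: le_trans (metric_triangle _ (g (k * t)) _) _; rewrite dE.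
have : t * (cone_dist v (geodesic_vector g (NngNum k0)) + eta / 2) <=
       t * (k - P + eta) by rewrite ler_pM2l//; lra.
by lra.
Unshelve. all: by end_near. Qed.

End Cone.

(** * Differentials of convex functions along geodesics *)

Lemma lipschitz_rectifiable {R : realType} {X : metricType R} (g : R -> X) (a b K : R) :
  (forall s t, a <= s <= b -> a <= t <= b -> mdist (g s) (g t) <= K * `|s - t|) ->
  rectifiable g a b.
Proof.
move=> lip; split.
  apply/subspace_continuousP => s /= sI.
  apply/metricType_numDomainType.cvgrPdist_lt => e e0.
  have K0 : 0 < `|K| + 1 by rewrite ltr_wpDl.
  apply/nbhs_ballP; exists (e / (`|K| + 1)); first by rewrite /= divr_gt0.
  move=> t; rewrite /ball/= ltr_pdivlMr// => st tI.
  rewrite !in_itv/= in sI tI; apply: le_lt_trans (lip s t sI tI) _.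
  apply: le_lt_trans st; rewrite mulrC ler_wpM2l//.
  by have := ler_norm K; lra.
apply: (@le_lt_trans _ _ (K * (b - a))%:E); last exact: ltry.
apply: curve_length_le => s sP; rewrite lee_fin.
suff H u : a <= u -> itv_partition u b s -> polyline_length mdist g u s <= K * (b - u).
  exact: H.
elim: s u {sP} => [|v s IH] u au.
  by move=> /itv_partition_nil ->; rewrite subrr mulr0.
move=> /[dup] /itv_partition_cons sP [/= /andP[uv _] _].
have vb := itv_partition_le sP.
have := IH v (le_trans au (ltW uv)) sP; have := lip u v.
rewrite au (le_trans (ltW uv) vb) (le_trans au (ltW uv)) vb => /(_ erefl erefl).
by rewrite distrC gtr0_norm ?subr_gt0//; lra.
Qed.

Section Differential.
Context {R : realType} {X : metricType R} (hX : @CAT0 R X).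
Context {x : X}.
Implicit Types (g h : geodesic_from x) (v w : tangent x) (e t : R) (r : {nonneg R}) (G : X -> R).

Lemma geodesic_from_restrict g (r : R) : 0 < r <= glen g ->
  exists2 h : geodesic_from x, gcurve h = gcurve g & glen h = r.
Proof.
move=> /andP[r0 rg]; have ig := isometric_onW rg (@gcurve_iso _ _ _ g).
by exists (@GeodesicFrom _ _ x g r r0 (@gcurve0 _ _ _ g) ig).
Qed.

Lemma rectifiable_geodesic g r :
  exists2 e, 0 < e & rectifiable (fun t => g (r%:num * t)) 0 e.
Proof.
have r0 : 0 <= r%:num by [].
have r1 : 0 < r%:num + 1 by lra.
exists (glen g / (r%:num + 1)); first by rewrite divr_gt0 ?glen_gt0.
have I t : 0 <= t <= glen g / (r%:num + 1) -> 0 <= r%:num * t <= glen g.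
  move=> /andP[t0]; rewrite ler_pdivlMr// => tl; apply/andP; split; first exact: mulr_ge0.
  by lra.
apply: (@lipschitz_rectifiable _ _ _ _ _ r%:num) => s t /I sI /I tI.
by rewrite (@gcurve_iso _ _ _ g)// -mulrBr normrM ger0_norm.
Qed.

(** The direction of [[x (g (r t))]] is [g] itself, cut at length [r t]. *)
Lemma right_tangent_geodesic g r :
  right_tangent (fun t => g (r%:num * t)) 0 (geodesic_vector hX g r).
Proof.
have near_r : \forall t \near 0^'+, 0 <= r%:num * t <= glen g.
  by apply: near_right0_scale_le => //; exact: glen_gt0.
split; first by rewrite mulr0 gcurve0.
  apply: cvg_near_cst; near=> t.
  have t0 : 0 < t by near: t; exact: nbhs_right_gt.
  rewrite metric_sym geodesic_from_mdist0; last by near: t.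
  by rewrite subr0 mulfK// gt_eqF.
move=> /= r0.
have /choice[dir dirP] (t : R) : exists h, gcurve h = gcurve g /\
    (0 < r%:num * t <= glen g -> glen h = r%:num * t).
  have [/geodesic_from_restrict[h hg hr]|_] := boolP (0 < r%:num * t <= glen g).
    by exists h.
  by exists g.
exists dir; split.
  near=> t; have t0 : 0 < t by near: t; exact: nbhs_right_gt.
  have [-> -> //] := dirP t; rewrite mulr_gt0//=.
  by have /andP[] : 0 <= r%:num * t <= glen g by near: t.
apply: cvg_near_cst; near=> t.
rewrite /seq_dist (_ : (fun n => _) = cst 0%E); first exact: lim_cst.
by apply/funext => n /=; rewrite intrinsic_dist_eq0//; exact: (dirP t).1.
Unshelve. all: by end_near. Qed.

Lemma is_differential_geodesic G D g r : is_differential G D ->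
  (G (g (r%:num * t)) - G x) / t @[t --> 0^'+] --> D (geodesic_vector hX g r).
Proof.
move=> [_ /(_ _ _ (rectifiable_geodesic g r) (right_tangent_geodesic g r))].
by rewrite mulr0 gcurve0.
Qed.

(** By convexity the difference quotients of [G] along [g] are bounded by the
    quotient over all of [g], up to the term in [lambda]; their limit is a
    value of the differential, which the gradient bounds from below. *)
Lemma down_gradient_slope lambda G v g :
  lambda_convex lambda G -> is_down_gradient G v ->
  - tprod v (geodesic_vector hX g 1%:nng) <=
    (G (g (glen g)) - G x) / glen g - lambda * glen g / 2.
Proof.
move=> conv [D [diff slope _]]; set l := glen g.
have l0 : 0 < l := glen_gt0 g.
apply: (le_trans (slope _)); apply/ler_addgt0Pr => e e0.
have e20 : 0 < e / 2 by rewrite divr_gt0.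
have : (G (g (1 * t)) - G x) / t @[t --> 0^'+] --> D (geodesic_vector hX g 1%:nng).
  exact: is_differential_geodesic diff.
move=> /cvgrPdist_lt/(_ _ e20) near_D.
have small : 0 < e / (`|lambda| + 1) by rewrite divr_gt0// ltr_wpDl.
have [t [tD /andP[t0 tl] /andP[_ te]]] : exists t, [/\
    `|D (geodesic_vector hX g 1%:nng) - (G (g (1 * t)) - G x) / t| < e / 2,
    0 < t < l & 0 < t < e / (`|lambda| + 1)].
  have /near_right0P[d d0 dP] : \forall t \near 0^'+, [/\
    `|D (geodesic_vector hX g 1%:nng) - (G (g (1 * t)) - G x) / t| < e / 2,
    0 < t < l & 0 < t < e / (`|lambda| + 1)].
    by near=> t; split; near: t => //; exact: near_right0_ltr.
  by exists (d / 2); apply: dP; lra.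
have xl : mdist x (g l) = l by apply: geodesic_from_mdist0; rewrite lexx ltW.
have tI : 0 <= t / l <= 1 by rewrite divr_ge0 ?(ltW t0) ?(ltW l0)//= ler_pdivrMr// mul1r ltW.
have Gg : geodesic x (g l) g by apply: geodesic_from_geodesic; rewrite lexx ltW.
have := conv _ _ _ (t / l) Gg tI; rewrite xl divfK ?gt_eqF// => le.
have lin : (G (g t) - G x) / t <= (G (g l) - G x) / l - lambda * l / 2 + lambda * t / 2.
  rewrite ler_pdivrMr//.
  have -> : ((G (g l) - G x) / l - lambda * l / 2 + lambda * t / 2) * t =
    (1 - t / l) * G x + t / l * G (g l) - t / l * (1 - t / l) * lambda * l ^+ 2 / 2 - G x.
    by field; rewrite gt_eqF.
  by lra.
have : lambda * t / 2 <= e / 2.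
  rewrite ler_pM2r ?invr_gt0//; move: te; rewrite ltr_pdivlMr ?ltr_wpDl// => te.
  apply: le_trans (ltW te); rewrite mulrC ler_pM2l//.
  by have := ler_norm lambda; lra.
move: tD; rewrite mul1r ltr_norml; lra.
Unshelve. all: by end_near. Qed.

Lemma down_gradient_lower_bound lambda G v y :
  lambda_convex lambda G -> is_down_gradient G v ->
  G x - tnorm v * mdist x y + lambda * mdist x y ^+ 2 / 2 <= G y.
Proof.
move=> conv grad; have [<-|xy] := eqVneq x y.
  by rewrite mdistxx expr0n/=; lra.
have [_ /(_ x y)[g [g0 g1 ig]] _] := hX.
have l0 : 0 < mdist x y by rewrite mdist_gt0.
pose g' := @GeodesicFrom _ _ x g _ l0 g0 ig.
have Pv : tprod v (geodesic_vector hX g' 1%:nng) <= tnorm v.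
  by apply: le_trans (tprod_le _ _) _; rewrite /= mulr1.
have : - tprod v (geodesic_vector hX g' 1%:nng) <=
    (G y - G x) / mdist x y - lambda * mdist x y / 2.
  by rewrite -[in G y]g1; exact: down_gradient_slope conv grad.
move=> le.
have : - tnorm v <= (G y - G x) / mdist x y - lambda * mdist x y / 2 by lra.
rewrite -(ler_pM2r l0).
have -> : ((G y - G x) / mdist x y - lambda * mdist x y / 2) * mdist x y =
    G y - G x - lambda * mdist x y ^+ 2 / 2.
  by field; rewrite gt_eqF.
by lra.
Qed.

(** The differential takes the value [- tnorm v ^+ 2] at [v]; being Lipschitz,
    it is almost as small at the vectors of the geodesics approximating [v],
    where it is a derivative of [G]. *)
Lemma down_gradient_ray G v e : is_down_gradient G v -> 0 < e ->
  \forall n \near \oo, \forall t \near 0^'+,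
    G (ray v n t) <= G x - t * (tnorm v ^+ 2 - e).
Proof.
move=> [D [diff _ Dv]] e0; rewrite tprodxx// in Dv.
case: v Dv => [|xi r] Dv.
  near=> n; near=> t; have t0 : 0 < t by near: t; exact: nbhs_right_gt.
  by rewrite /= expr0n/= sub0r mulrN opprK lerDl mulr_ge0// ltW.
have [[K lipD] _] := diff.
have K0 : 0 < `|K| + 1 by rewrite ltr_wpDl.
pose d := e / 2 / (`|K| + 1).
have d0 : 0 < d by rewrite !divr_gt0.
have dE : d * (`|K| + 1) = e / 2 by rewrite divfK// gt_eqF.
have r0 : 0 <= r%:num by [].
pose c := d ^+ 2 / (2 * r%:num ^+ 2 + 1).
have den0 : 0 < 2 * r%:num ^+ 2 + 1 by have := sqr_ge0 r%:num; lra.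
have c0 : 0 < c by rewrite divr_gt0// exprn_gt0.
have cE : c * (2 * r%:num ^+ 2 + 1) = d ^+ 2 by rewrite divfK// gt_eqF.
apply: filterS (cos_cone_angle_geodesic_near hX xi c0) => n near_cos.
have close : cone_dist (geodesic_vector hX (xi n) r) (Tvec xi r) <= d.
  rewrite -ler_sqr ?nnegrE ?cone_dist_ge0 ?(ltW d0)// cone_dist_sqr /=.
  have : r%:num ^+ 2 * (1 - c) <=
    r%:num ^+ 2 * cos (cone_angle (geodesic_direction hX (xi n)) xi).
    by rewrite ler_wpM2l ?sqr_ge0.
  by lra.
have Dn : D (geodesic_vector hX (xi n) r) <= D (Tvec xi r) + e / 2.
  have := lipD (geodesic_vector hX (xi n) r) (Tvec xi r).
  have : K * cone_dist (geodesic_vector hX (xi n) r) (Tvec xi r) <= (`|K| + 1) * d.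
    apply: (@le_trans _ _ ((`|K| + 1) * cone_dist (geodesic_vector hX (xi n) r) (Tvec xi r))).
      by rewrite ler_wpM2r ?cone_dist_ge0//; have := ler_norm K; lra.
    by rewrite ler_wpM2l// ltW.
  rewrite [X in _ <= X]mulrC dE; move=> h1 /le_trans/(_ h1); rewrite ler_norml; lra.
have e20 : 0 < e / 2 by rewrite divr_gt0.
have := is_differential_geodesic (g := xi n) (r := r) diff.
move=> /cvgrPdist_lt/(_ _ e20) near_D; near=> t.
have t0 : 0 < t by near: t; exact: nbhs_right_gt.
have : `|D (geodesic_vector hX (xi n) r) - (G (xi n (r%:num * t)) - G x) / t| < e / 2.
  by near: t.
rewrite ltr_norml => /andP[/ltW lo _].
have : (G (xi n (r%:num * t)) - G x) / t <= - tnorm (Tvec xi r) ^+ 2 + e by lra.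
by rewrite ler_pdivrMr// /ray; lra.
Unshelve. all: by end_near. Qed.

End Differential.

(** * Gradient curves are tangent to geodesics *)

(** The numerical part of [gradient_curve_ray].  There [a], [b], [c] are the
    distances from [x] to a point [p], from [p] to a point [q] with
    [mdist x q = r t], and from [x] to the midpoint of [p] and [q].  If [c]
    is almost [r t], the median inequality leaves no room for [b]. *)
Lemma near_optimal_midpoint {R : realType} (r e eta t lambda a b c : R) :
  0 < r -> 0 < e -> e <= 1 -> 2 * e <= r ^+ 2 -> e * (4 * r + 18) <= eta ^+ 2 ->
  0 <= eta -> 0 < t -> t * (`|lambda| * (2 * r + 2) ^+ 2 + 1) <= e ->
  0 <= c -> 0 <= b -> 0 <= a -> a <= (r + e) * t -> b <= a + r * t ->
  c ^+ 2 <= a ^+ 2 / 2 + (r * t) ^+ 2 / 2 - b ^+ 2 / 4 ->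
  t * (r ^+ 2 - e) + lambda * (c ^+ 2 / 2 + b ^+ 2 / 8) <= r * c ->
  b <= eta * t.
Proof.
move=> r0 e0 e1 er eeta eta0 t0 tC c0 b0 a0 a_le b_le med mid.
have te : t * e <= t by rewrite ger_pMr.
have te0 : 0 <= t * e by rewrite mulr_ge0// ltW.
set Q := ((2 * r + 2) * t) ^+ 2.
have a2 : a ^+ 2 <= ((r + e) * t) ^+ 2.
  by clear - a_le a0 r0 e0 t0; rewrite ler_sqr ?nnegrE// mulr_ge0//; lra.
have b2 : b ^+ 2 <= Q.
  clear - a_le b_le b0 r0 t0 te.
  have h0 : 0 <= (2 * r + 2) * t by rewrite mulr_ge0 ?(ltW t0)//; lra.
  by rewrite ler_sqr ?nnegrE//; lra.
have c2 : c ^+ 2 <= Q / 2.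
  have r1 : ((r + e) * t) ^+ 2 <= ((r + 1) * t) ^+ 2.
    have h0 : 0 <= (r + 1) * t by rewrite mulr_ge0 ?(ltW t0)//; lra.
    by rewrite ler_sqr ?nnegrE ?(le_trans a0 a_le)// ler_pM2r// lerD2l.
  have := sqr_ge0 b.
  have : 0 <= t ^+ 2 * (2 * r ^+ 2 + 6 * r + 3).
    by rewrite mulr_ge0 ?sqr_ge0//; have := sqr_ge0 r; clear - r0; lra.
  by clear - med a2 r1; rewrite /Q; lra.
have rc : t * (r ^+ 2 - 2 * e) <= r * c.
  have z0 : 0 <= c ^+ 2 / 2 + b ^+ 2 / 8 by have := sqr_ge0 b; have := sqr_ge0 c; clear; lra.
  have : - lambda * (c ^+ 2 / 2 + b ^+ 2 / 8) <= `|lambda| * (c ^+ 2 / 2 + b ^+ 2 / 8).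
    by rewrite ler_wpM2r// ler_normr lexx orbT.
  have : `|lambda| * (c ^+ 2 / 2 + b ^+ 2 / 8) <= `|lambda| * Q.
    by rewrite ler_wpM2l//; have := sqr_ge0 b; clear - b2 c2; lra.
  have : `|lambda| * Q <= t * e.
    rewrite (_ : `|lambda| * Q = t * (t * (`|lambda| * (2 * r + 2) ^+ 2))).
      by rewrite ler_pM2l//; clear - tC t0; lra.
    by rewrite /Q; ring.
  by clear - mid; lra.
have rc2 : (t * (r ^+ 2 - 2 * e)) ^+ 2 <= (r * c) ^+ 2.
  have h0 : 0 <= t * (r ^+ 2 - 2 * e) by rewrite mulr_ge0 ?subr_ge0// ltW.
  by rewrite ler_sqr ?nnegrE ?(le_trans h0).
have rb2 : (r * b) ^+ 2 <= (r * t) ^+ 2 * (e * (4 * r + 18)).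
  have : r ^+ 2 * b ^+ 2 <= r ^+ 2 * (2 * ((r + e) * t) ^+ 2 + 2 * (r * t) ^+ 2 - 4 * c ^+ 2).
    by rewrite ler_wpM2l ?sqr_ge0//; clear - med a2; lra.
  have : 0 <= (r * t) ^+ 2 * e * (1 - e).
    by rewrite mulr_ge0 ?subr_ge0// mulr_ge0 ?sqr_ge0// ltW.
  have := sqr_ge0 (t * e).
  by clear - rc2; lra.
have : (r * b) ^+ 2 <= (r * (eta * t)) ^+ 2.
  apply: le_trans rb2 _; rewrite (_ : (r * (eta * t)) ^+ 2 = (r * t) ^+ 2 * eta ^+ 2).
    by rewrite ler_wpM2l ?sqr_ge0.
  by ring.
by rewrite ler_sqr ?nnegrE ?mulr_ge0 ?(ltW r0) ?(ltW t0)// ler_pM2l.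
Qed.

Section GradientCurves.
Context {R : realType} {X : metricType R} (hX : @CAT0 R X).
Implicit Types (x y : X) (G : X -> R) (p : R -> X) (e eta lambda : R).

(** Both differentials have the same value at [v], because [p] realizes [v];
    this gives [tnorm v <= tnorm w].  Conversely [G] decreases along the rays
    of [w] at rate [tnorm w ^+ 2], and it cannot decrease faster than
    [tnorm v] per unit of distance. *)
Lemma down_gradient_norm_eq lambda G p x (v w : tangent x) :
  lambda_convex lambda G -> is_down_gradient G v -> is_down_gradient G w ->
  (exists2 e, 0 < e & rectifiable p 0 e) -> right_tangent p 0 v ->
  tnorm v = tnorm w.
Proof.
move=> conv gv gw rect tan.
have [r0 s0] := (tnorm_ge0 v, tnorm_ge0 w).
have le_vw : tnorm v ^+ 2 <= tnorm w * tnorm v.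
  have [D [[_ diffD] _ Dv]] := gv; have [D' [[_ diffD'] slope _]] := gw.
  have : D v = D' v.
    by apply: cvg_unique (diffD _ _ rect tan) (diffD' _ _ rect tan); exact: norm_hausdorff.
  rewrite Dv tprodxx// => E; have := slope v; rewrite -E.
  by have := tprod_le w v; lra.
have le_wv : tnorm w ^+ 2 <= tnorm v * tnorm w.
  apply/ler_addgt0Pr => e e0; have e20 : 0 < e / 2 by rewrite divr_gt0.
  have [n near_t] := filter_ex (down_gradient_ray hX gw e20).
  pose C := `|lambda| * tnorm w ^+ 2 + 1.
  have C0 : 0 < C by rewrite ltr_wpDl// mulr_ge0// sqr_ge0.
  have small : 0 < e / C by rewrite divr_gt0.
  have /near_right0P[d d0 dP] : \forall t \near 0^'+, [/\
      G (ray w n t) <= G x - t * (tnorm w ^+ 2 - e / 2),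
      mdist x (ray w n t) = tnorm w * t & 0 < t < e / C].
    near=> t; split; near: t; first exact: near_t.
      exact: ray_mdist.
    exact: near_right0_ltr.
  have [] := dP (d / 2); first by lra.
  set t := d / 2 => Gle rE /andP[t0]; rewrite ltr_pdivlMr// => tC.
  have := down_gradient_lower_bound hX (ray w n t) conv gv; rewrite rE => Gge.
  have lamb : - (lambda * (tnorm w * t) ^+ 2) <= t * (t * (`|lambda| * tnorm w ^+ 2)).
    rewrite (_ : t * _ = `|lambda| * (tnorm w * t) ^+ 2); last by ring.
    by rewrite -mulNr ler_wpM2r ?sqr_ge0// ler_normr lexx orbT.
  rewrite -(ler_pM2l t0).
  have : t * (t * (`|lambda| * tnorm w ^+ 2)) <= t * e.
    by rewrite ler_pM2l//; move: tC; rewrite /C; lra.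
  by lra.
have [r_eq0|rN0] := eqVneq (tnorm v) 0.
  move: le_wv; rewrite r_eq0 mul0r => h; apply/esym/eqP; rewrite -sqrf_eq0.
  by rewrite eq_le h sqr_ge0.
have rp : 0 < tnorm v by rewrite lt_def rN0.
have vw : tnorm v <= tnorm w by rewrite -(ler_pM2r rp) -expr2.
have wp : 0 < tnorm w := lt_le_trans rp vw.
by apply/eqP; rewrite eq_le vw -(ler_pM2r wp) -expr2.
Unshelve. all: by end_near. Qed.

(** The crucial point: a gradient curve is tangent, in the distance of [X], to
    the geodesics that approximate a downward gradient.  At time [t] the curve
    and the ray are at distance about [r t] from [x], and at both points [G]
    has dropped by about [r ^+ 2 t].  By convexity it has dropped as much at
    their midpoint; since [G] drops by at most [r] per unit of distance, the
    midpoint is at distance at least about [r t] from [x] as well.  A midpoint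
    as far from [x] as the endpoints forces the endpoints to be close. *)
Lemma gradient_curve_ray lambda G p x (v w : tangent x) eta :
  lambda_convex lambda G -> is_down_gradient G v -> is_down_gradient G w ->
  (exists2 e, 0 < e & rectifiable p 0 e) -> right_tangent p 0 v -> 0 < eta ->
  \forall n \near \oo, \forall t \near 0^'+, mdist (p t) (ray w n t) <= eta * t.
Proof.
move=> conv gv gw rect tan eta0.
have vw := down_gradient_norm_eq conv gv gw rect tan.
have := tnorm_ge0 v; set r := tnorm v => r0.
have [p0 speed _] := tan.
have near_speed e : 0 < e -> \forall t \near 0^'+, mdist x (p t) <= (r + e) * t.
  move=> e0; move/cvgrPdist_lt : speed => /(_ e e0) speed; near=> t.
  have t0 : 0 < t by near: t; exact: nbhs_right_gt.
  have : `|tnorm v - mdist (p t) x / (t - 0)| < e by near: t.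
  rewrite subr0 ltr_norml metric_sym -ler_pdivrMr// -/r; lra.
have [req0|rN0] := eqVneq r 0.
  near=> n; near=> t.
  have t0 : 0 < t by near: t; exact: nbhs_right_gt.
  apply: le_trans (metric_triangle _ x _) _; rewrite metric_sym.
  have -> : mdist x (ray w n t) = tnorm w * t by near: t; exact: ray_mdist.
  rewrite -vw -/r req0 mul0r addr0.
  have : mdist x (p t) <= (r + eta) * t by near: t; exact: near_speed.
  by rewrite req0 add0r.
have rp : 0 < r by rewrite lt_def rN0.
have den0 : 0 < 4 * r + 18 by lra.
(* the precision required by [near_optimal_midpoint] *)
pose e := Num.min 1 (Num.min (r ^+ 2 / 2) (eta ^+ 2 / (4 * r + 18))).
have e0 : 0 < e by rewrite !lt_min ltr01 !divr_gt0// exprn_gt0.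
have e1 : e <= 1 by rewrite ge_min lexx.
have er : 2 * e <= r ^+ 2.
  have : e <= r ^+ 2 / 2 by rewrite !ge_min lexx orbT.
  by lra.
have eeta : e * (4 * r + 18) <= eta ^+ 2.
  by rewrite -ler_pdivlMr// !ge_min lexx !orbT.
clearbody e.
have near_G : \forall t \near 0^'+, G (p t) <= G x - t * (r ^+ 2 - e).
  have [D [[_ diff] _ Dv]] := gv; rewrite tprodxx// -/r in Dv.
  have /cvgrPdist_lt/(_ e e0) near_D := diff _ _ rect tan.
  near=> t; have t0 : 0 < t by near: t; exact: nbhs_right_gt.
  have : `|D v - (G (p t) - G (p 0)) / t| < e by near: t.
  rewrite ltr_norml p0 Dv => /andP[/ltW lo _].
  have : (G (p t) - G x) / t <= - r ^+ 2 + e by lra.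
  by rewrite ler_pdivrMr//; lra.
apply: filterS (down_gradient_ray hX gw e0) => n near_ray; rewrite -vw -/r in near_ray.
(* bounds the second-order terms of [G], at times of order [e] *)
pose C := `|lambda| * (2 * r + 2) ^+ 2 + 1.
have C0 : 0 < C by rewrite ltr_wpDl// mulr_ge0// sqr_ge0.
near=> t.
have t0 : 0 < t by near: t; exact: nbhs_right_gt.
have d1 : mdist x (p t) <= (r + e) * t by near: t; exact: near_speed.
have d2 : mdist x (ray w n t) = r * t by rewrite /r vw; near: t; exact: ray_mdist.
have G1 : G (p t) <= G x - t * (r ^+ 2 - e) by near: t.
have G2 : G (ray w n t) <= G x - t * (r ^+ 2 - e) by near: t.
have tC : t * C <= e.
  rewrite -ler_pdivlMr//; near: t; apply: nbhs_right_le; exact: divr_gt0.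
have [_ /(_ (p t) (ray w n t))[g Gg] _] := hX.
have := CAT0_median hX x Gg; rewrite (metric_sym (p t) x) (metric_sym (ray w n t) x) d2.
rewrite (metric_sym (g _) x).
have := metric_triangle (p t) x (ray w n t); rewrite (metric_sym (p t) x) d2.
have half : 0 <= (2^-1 : R) <= 1 by lra.
have := conv _ _ _ 2^-1 Gg half; rewrite (mulrC 2^-1).
have := down_gradient_lower_bound hX (g (mdist (p t) (ray w n t) / 2)) conv gv.
rewrite -/r; set m := g _.
have := mdist_ge0 (p t) (ray w n t); have := mdist_ge0 x m; have := mdist_ge0 x (p t).
move: d1 G1 G2; set a := mdist x (p t); set b := mdist (p t) _; set c := mdist x m.
move=> d1 G1 G2 a0 c0 b0 Gm1 Gm2 bar med.
by apply: (near_optimal_midpoint rp e0 e1 er eeta (ltW eta0) t0 tC c0 b0 a0 d1 bar med); lra.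
Unshelve. all: by end_near. Qed.

End GradientCurves.

(** * Comparison of two gradient curves *)

(** A Gronwall inequality on a short interval: as long as [f t <= M t], with
    [M] slightly larger than [2 beta], the term [L * f] is at most [M / 4], so
    that [f] grows at a rate below [M]. *)
Lemma linear_growth_bound {R : realType} (f : R -> R) (L beta S : R) :
  0 <= L -> 0 <= beta -> L * S <= 4^-1 -> f 0 <= 0 ->
  (forall t e, 0 < t <= S -> 0 < e -> exists2 d, 0 < d &
     forall u, 0 <= u < t -> t - u < d -> f t <= f u + e) ->
  (forall t eta, 0 <= t < S -> 0 < eta -> \forall h \near 0^'+,
     f (t + h) <= f t + h * (L * f t + beta + eta)) ->
  forall s, 0 <= s <= S -> f s <= 2 * beta * s.
Proof.
move=> L0 beta0 LS f0 left right s /andP[s0 sS].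
suff H eta : 0 < eta -> f s <= (2 * beta + eta) * s.
  have [s_eq0|sN0] := eqVneq s 0; first by rewrite s_eq0 mulr0.
  have sp : 0 < s by rewrite lt_def sN0.
  apply/ler_addgt0Pr => e e0; have := H (e / s); rewrite divr_gt0// => /(_ erefl).
  by rewrite mulrDl divfK// gt_eqF.
move=> eta0; set M := 2 * beta + eta.
have M0 : 0 < M by rewrite /M; lra.
pose E := [set t | 0 <= t <= S /\ forall u, 0 <= u <= t -> f u <= M * u].
have S0 : 0 <= S := le_trans s0 sS.
have E0 : E 0.
  split; first by rewrite lexx.
  by move=> u u0; rewrite (_ : u = 0) ?mulr0//; lra.
have supE : has_sup E by split; [exists 0|exists S => t [/andP[]]].
set T := sup E.
have TS : T <= S by apply: ge_sup; [exists 0|move=> t [/andP[]]].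
have T0 : 0 <= T by apply: ub_le_sup E0; exact: supE.2.
have below u : 0 <= u < T -> f u <= M * u.
  move=> /andP[u0 uT]; have Tu0 : 0 < T - u by rewrite subr_gt0.
  have [t [_ Et] ut] := sup_adherent Tu0 supE.
  by apply: Et; move: ut; rewrite u0 -/T; lra.
have at_T : f T <= M * T.
  have [T_eq0|TN0] := eqVneq T 0; first by rewrite T_eq0 mulr0.
  have Tp : 0 < T by rewrite lt_def TN0.
  apply/ler_addgt0Pr => e e0; have [|d d0 dP] := left T e _ e0; first by rewrite Tp.
  pose u := Num.max 0 (T - d / 2).
  have uT : 0 <= u < T by rewrite le_max lexx/= gt_max Tp; lra.
  have Tud : T - u < d.
    by have : T - d / 2 <= u; [rewrite le_max lexx orbT|lra].
  have := dP u uT Tud; have := below u uT.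
  have : M * u <= M * T by rewrite ler_pM2l//; lra.
  by lra.
have ET u : 0 <= u <= T -> f u <= M * u.
  move=> /andP[u0]; rewrite le_eqVlt => /predU1P[->//|uT].
  by apply: below; rewrite u0.
suff TE : T = S by apply: ET; rewrite s0 TE.
apply/eqP; rewrite eq_le TS/= leNgt; apply/negP => ltTS.
have eta4 : 0 < eta / 4 by rewrite divr_gt0.
have [|d d0 dP] := (near_right0P _).1 (right T (eta / 4) _ eta4); first by rewrite T0.
pose h := Num.min (d / 2) (S - T).
have hp : 0 < h by rewrite lt_min divr_gt0//= subr_gt0.
suff : E (T + h) by move=> /(ub_le_sup supE.2); rewrite -/T; lra.
split; first by have : h <= S - T; [rewrite ge_min lexx orbT|lra].
move=> u /andP[u0 uTh]; have [uT|Tu] := leP u T; first by apply: ET; rewrite u0.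
have hd : h <= d / 2 by rewrite ge_min lexx.
have := dP (u - T); rewrite subr_gt0 Tu [T + _]addrC subrK => /(_ ltac:(lra)) le.
apply: (le_trans le).
have LfT : L * f T <= M / 4.
  apply: (@le_trans _ _ (M * (L * S))); last by rewrite ler_pM2l.
  rewrite mulrCA ler_wpM2l//; apply: (le_trans at_T).
  by rewrite ler_pM2l.
have : (u - T) * (L * f T + beta + eta / 4) <= (u - T) * M.
  by rewrite ler_pM2l ?subr_gt0// /M; move: LfT; rewrite /M; lra.
by lra.
Qed.

Section Comparison.
Context {R : realType} {X : metricType R} (hX : @CAT0 R X).
Context {lambda : R} {F1 F2 : X -> R}.
Context (conv1 : lambda_convex lambda F1) (conv2 : lambda_convex lambda F2).

(** At [x] the first curve follows the gradient [a1] of [F1], which is within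
    [beta] of the gradient [a2] of [F2].  So, up to [beta t], the curves move
    like two gradient curves of the same function [F2].  If [x != y], their
    distance is estimated through the midpoint of a geodesic [[x y]]: each end
    approaches it at a rate given by the first variation, and
    [lambda]-convexity of [F2] along [[x y]] bounds the sum of the two slopes
    by [- lambda * mdist x y]. *)
Lemma gradient_curves_mdist_growth (p1 p2 : R -> X) x y
    (v1 a1 a2 : tangent x) (v2 : tangent y) (beta eta : R) :
  is_down_gradient F1 v1 -> is_down_gradient F2 v2 ->
  is_down_gradient F1 a1 -> is_down_gradient F2 a2 -> cone_dist a1 a2 <= beta ->
  (exists2 e, 0 < e & rectifiable p1 0 e) -> right_tangent p1 0 v1 ->
  (exists2 e, 0 < e & rectifiable p2 0 e) -> right_tangent p2 0 v2 -> 0 < eta ->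
  \forall t \near 0^'+, mdist (p1 t) (p2 t) <=
    mdist x y + t * (`|lambda| * mdist x y + beta + eta).
Proof.
move=> gv1 gv2 ga1 ga2 dist_a rect1 tan1 rect2 tan2 eta0.
have e0 : 0 < eta / 5 by rewrite divr_gt0.
have near_p1 := gradient_curve_ray hX conv1 gv1 ga1 rect1 tan1 e0.
have near_a := ray_mdist_near hX a1 a2 e0.
have le_beta t : 0 < t -> t * (cone_dist a1 a2 + eta / 5) <= t * (beta + eta / 5).
  by move=> t0; rewrite ler_pM2l//; lra.
have [xy|xy] := eqVneq x y.
  subst y; have near_p2 := gradient_curve_ray hX conv2 gv2 ga2 rect2 tan2 e0.
  have [n [[near1 near2] near3]] := filter_ex (filterI (filterI near_p1 near_a) near_p2).
  near=> t; have t0 : 0 < t by near: t; exact: nbhs_right_gt.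
  have le1 : mdist (p1 t) (ray a1 n t) <= eta / 5 * t by near: t.
  have le2 : mdist (ray a1 n t) (ray a2 n t) <= t * (cone_dist a1 a2 + eta / 5) by near: t.
  have le3 : mdist (p2 t) (ray a2 n t) <= eta / 5 * t by near: t.
  rewrite mdistxx mulr0; have := le_beta t t0.
  have := metric_triangle (p1 t) (ray a1 n t) (p2 t).
  have := metric_triangle (ray a1 n t) (ray a2 n t) (p2 t).
  have := mulr_gt0 t0 eta0.
  by rewrite (metric_sym (ray a2 n t) (p2 t)); lra.
have d0 : 0 < mdist x y by rewrite mdist_gt0.
have [_ /(_ x y)[g Gg] _] := hX.
have [g0 g1 ig] := Gg; have [h0 h1 ih] := geodesic_rev Gg.
rewrite (metric_sym y x) in h1 ih.
pose gx := @GeodesicFrom _ _ x g _ d0 g0 ig.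
pose gy := @GeodesicFrom _ _ y _ _ d0 h0 ih.
pose l := mdist x y / 2.
have lx : 0 < l <= glen gx by rewrite /l/=; lra.
have ly : 0 < l <= glen gy by rewrite /l/=; lra.
have gxy : gy l = gx l by rewrite /gx /gy /=; congr g; rewrite /l; field.
have near_p2 := gradient_curve_ray hX conv2 gv2 gv2 rect2 tan2 e0.
have near_x := ray_mdist_geodesic hX a2 lx e0.
have near_y := ray_mdist_geodesic hX v2 ly e0.
have [n [[[[near1 near2] near3] near4] near5]] := filter_ex (filterI (filterI
  (filterI (filterI near_p1 near_a) near_p2) near_x) near_y).
have slope : - tprod a2 (geodesic_vector hX gx 1%:nng)
             - tprod v2 (geodesic_vector hX gy 1%:nng) <= `|lambda| * mdist x y.
  have := down_gradient_slope hX gx conv2 ga2.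
  have := down_gradient_slope hX gy conv2 gv2.
  have -> : gy (glen gy) = x by exact: h1.
  have -> : gx (glen gx) = y by exact: g1.
  have -> : glen gx = mdist x y by [].
  have -> : glen gy = mdist x y by [].
  have : - lambda * mdist x y <= `|lambda| * mdist x y.
    by rewrite ler_pM2r// ler_normr lexx orbT.
  rewrite -(opprB (F2 y) (F2 x)) mulNr; lra.
near=> t; have t0 : 0 < t by near: t; exact: nbhs_right_gt.
have le1 : mdist (p1 t) (ray a1 n t) <= eta / 5 * t by near: t.
have le2 : mdist (ray a1 n t) (ray a2 n t) <= t * (cone_dist a1 a2 + eta / 5) by near: t.
have le3 : mdist (p2 t) (ray v2 n t) <= eta / 5 * t by near: t.
have le4 : mdist (ray a2 n t) (gx l) <=
  l + t * (eta / 5 - tprod a2 (geodesic_vector hX gx 1%:nng)) by near: t.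
have le5 : mdist (ray v2 n t) (gx l) <=
  l + t * (eta / 5 - tprod v2 (geodesic_vector hX gy 1%:nng)).
  by rewrite -gxy; near: t.
have := le_beta t t0.
have := metric_triangle (p1 t) (ray a1 n t) (p2 t).
have := metric_triangle (ray a1 n t) (ray a2 n t) (p2 t).
have := metric_triangle (ray a2 n t) (gx l) (p2 t).
have := metric_triangle (gx l) (ray v2 n t) (p2 t).
rewrite (metric_sym (ray v2 n t) (p2 t)) (metric_sym (gx l) (ray v2 n t)).
have : t * (- tprod a2 (geodesic_vector hX gx 1%:nng)
           - tprod v2 (geodesic_vector hX gy 1%:nng)) <= t * (`|lambda| * mdist x y).
  by rewrite ler_pM2l.
have : l + l = mdist x y by rewrite /l -splitr.
by lra.
Unshelve. all: by end_near. Qed.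

End Comparison.

Section Curves.
Context {R : realType} {X : metricType R}.
Implicit Types (x : X) (G : X -> R) (mu : R -> X) (I : set R).

Lemma right_tangent_shift mu (t : R) x (v : tangent x) :
  right_tangent mu t v -> right_tangent (fun h => mu (t + h)) 0 v.
Proof.
move=> [mut speed dirs]; split; first by rewrite addr0.
  have shift : mdist (mu (t + h)) x / (t + h - t) @[h --> 0^'+] --> tnorm v.
    by move=> A /speed; exact: (near_at_right_shift _ _).1.
  suff -> : (fun h => mdist (mu (t + h)) x / (h - 0)) =
      (fun h => mdist (mu (t + h)) x / (t + h - t)) by [].
  by apply/funext => h; congr (_ / _); ring.
case: v dirs {speed} => // xi r dirs r0; have [dir [near_dir cvg_dir]] := dirs r0.
exists (fun h => dir (t + h)); split.
  exact: (near_at_right_shift _ (fun u => dir u (glen (dir u)) = mu u)).1 near_dir.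
by move=> A /cvg_dir; exact: (near_at_right_shift _ _).1.
Qed.

(** The intervals [(0, oo)] and [(0, c]] contain, with any point, all smaller
    positive ones; 0 is then a limit of points of the interval, and there is
    nothing to prove when the interval is empty. *)
Lemma closure_time_interval_le (A : \bar R) s t :
  closure (time_interval A) s -> 0 <= t <= s -> closure (time_interval A) t.
Proof.
have down u v : time_interval A u -> 0 < v <= u -> time_interval A v.
  rewrite /time_interval; case: ifP => _ /=; rewrite !in_itv/=.
    by move=> _ /andP[-> _].
  by move=> /andP[_ ua] /andP[-> vu]; exact: le_trans ua.
have pos u : time_interval A u -> 0 < u.
  by rewrite /time_interval; case: ifP => _ /=; rewrite in_itv/= => /andP[].
move=> cs /andP[t0 ts].
have [<-//|tNs] := eqVneq s t.
have ltts : t < s by rewrite lt_def tNs.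
have [u Au tu] : exists2 u, time_interval A u & t < u.
  have st0 : 0 < s - t by rewrite subr_gt0.
  have [u [Au]] := cs _ (nbhsx_ballx s _ st0).
  rewrite /ball/= => su; exists u => //.
  by move: su; rewrite ltr_norml; lra.
move=> U /nbhs_ballP[d /= d0 dU].
pose w := Num.min u (t + d / 2).
have tw : t < w by rewrite lt_min tu; lra.
exists w; split.
  by apply: down Au _; rewrite (le_lt_trans t0 tw) ge_min lexx.
apply: dU; rewrite /ball/= distrC gtr0_norm ?subr_gt0//.
by have : w <= t + d / 2; [rewrite ge_min lexx orbT|lra].
Qed.

Lemma gradient_curve_right G I mu (t s : R) : gradient_curve G I mu ->
  (forall u, t <= u <= s -> I u) -> t < s ->
  (exists2 e, 0 < e & rectifiable (fun h => mu (t + h)) 0 e) /\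
  exists2 v : tangent (mu t), right_tangent (fun h => mu (t + h)) 0 v &
    is_down_gradient G v.
Proof.
move=> [lip tan] Its ts; have It : I t by apply: Its; rewrite lexx ltW.
split; last first.
  have [|v [tv gv]] := tan t It; last by exists v => //; exact: right_tangent_shift.
  by exists s => //; apply: Its; rewrite lexx ltW.
have [e e0 [K KP]] := lip t It.
have m0 : 0 < Num.min (e / 2) (s - t) by rewrite lt_min divr_gt0//= subr_gt0.
exists (Num.min (e / 2) (s - t)) => //.
have J u : 0 <= u <= Num.min (e / 2) (s - t) -> I (t + u) /\ `|t + u - t| < e.
  move=> /andP[u0]; rewrite le_min => /andP[ue us].
  by split; [apply: Its; lra|rewrite addrC addKr ger0_norm; lra].
apply: (@lipschitz_rectifiable _ _ _ _ _ K) => u v /J[Iu ue] /J[Iv ve].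
apply: le_trans (KP _ _ Iu Iv ue ve) _.
by rewrite (_ : t + u - (t + v) = u - v)//; ring.
Qed.

Lemma gradient_curve_left_mdist G I mu (t e : R) : gradient_curve G I mu -> I t ->
  0 < e -> exists2 d, 0 < d & forall u, I u -> `|u - t| < d -> mdist (mu t) (mu u) <= e.
Proof.
move=> [lip _] It e0; have [d d0 [K KP]] := lip t It.
have K0 : 0 < `|K| + 1 by rewrite ltr_wpDl.
exists (Num.min d (e / (`|K| + 1))); first by rewrite lt_min d0 divr_gt0.
move=> u Iu; rewrite lt_min ltr_pdivlMr// => /andP[ud ue].
rewrite metric_sym; apply: le_trans (KP u t Iu It ud _) _.
  by rewrite subrr normr0.
apply: le_trans (ltW ue); rewrite mulrC ler_wpM2l//.
by have := ler_norm K; lra.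
Qed.

End Curves.

Unset Implicit Arguments.

Theorem theorem25 (R : realType) (X : metricType R) (hX : @CAT0 R X)
  (x0 y : X) (t1 t2 lambda : R) (F : R -> X -> R)
  (hLip : forall t, locally_lipschitz (F t))
  (hconv : forall t, lambda_convex lambda (F t))
  (B alpha : R) (hB : 0 < B) (halpha : 0 < alpha)
  (hgrad : forall x : X, exists v1 v2 : tangent x,
     [/\ is_down_gradient (F t1) v1, is_down_gradient (F t2) v2
       & cone_dist v1 v2 <= B * `|t1 - t2| `^ alpha])
  (mu1 mu2 : R -> X)
  (hmu1 : gradient_curve (F t1) (closure (time_interval (growth (F t1) y))) mu1)
  (hmu2 : gradient_curve (F t2) (closure (time_interval (growth (F t2) y))) mu2)
  (hmu1_0 : mu1 0 = x0) (hmu2_0 : mu2 0 = x0) :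
  exists T : R, 0 < T /\
    forall s : R,
      closure (time_interval (growth (F t1) y)) s ->
      closure (time_interval (growth (F t2) y)) s ->
      0 <= s <= T ->
      mdist (mu1 s) (mu2 s) <= 2 * B * s * `|t1 - t2| `^ alpha.
Proof.
have l1 : 0 < 4 * (`|lambda| + 1) by rewrite mulr_gt0// ltr_wpDl.
exists (4 * (`|lambda| + 1))^-1; split; first by rewrite invr_gt0.
move=> s I1s I2s /andP[s0 sT].
have beta0 : 0 <= B * `|t1 - t2| `^ alpha by rewrite mulr_ge0 ?powR_ge0// ltW.
rewrite [leRHS](_ : _ = 2 * (B * `|t1 - t2| `^ alpha) * s); last by ring.
have I1 t : 0 <= t <= s -> closure (time_interval (growth (F t1) y)) t.
  exact: closure_time_interval_le.
have I2 t : 0 <= t <= s -> closure (time_interval (growth (F t2) y)) t.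
  exact: closure_time_interval_le.
apply: (@linear_growth_bound _ (fun t => mdist (mu1 t) (mu2 t)) `|lambda| _ s) => //.
- rewrite -(ler_pM2l l1) in sT; rewrite divff ?gt_eqF// in sT.
  by lra.
- by rewrite hmu1_0 hmu2_0 mdistxx.
- move=> t e /andP[t0 ts] e0; have e20 : 0 < e / 2 by rewrite divr_gt0.
  have tI : 0 <= t <= s by rewrite ts ltW.
  have [d d0 dP] := gradient_curve_left_mdist hmu1 (I1 t tI) e20.
  have [d' d'0 d'P] := gradient_curve_left_mdist hmu2 (I2 t tI) e20.
  exists (Num.min d d'); first by rewrite lt_min d0.
  move=> u /andP[u0 ut]; rewrite lt_min => /andP[tud tud'].
  have uI : 0 <= u <= s by rewrite u0 (le_trans (ltW ut)).
  have := dP u (I1 u uI); have := d'P u (I2 u uI).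
  rewrite distrC gtr0_norm ?subr_gt0// => /(_ tud') le2 /(_ tud) le1.
  have := metric_triangle (mu1 t) (mu1 u) (mu2 t).
  have := metric_triangle (mu1 u) (mu2 u) (mu2 t).
  by rewrite (metric_sym (mu2 u) (mu2 t)); lra.
- move=> t eta /andP[t0 ts] eta0.
  have Its u : t <= u <= s -> 0 <= u <= s by move=> /andP[tu ->]; rewrite (le_trans t0).
  have [rect1 [v1 tan1 gv1]] := gradient_curve_right hmu1 (fun u h => I1 u (Its u h)) ts.
  have [rect2 [v2 tan2 gv2]] := gradient_curve_right hmu2 (fun u h => I2 u (Its u h)) ts.
  have [a1 [a2 [ga1 ga2 dist_a]]] := hgrad (mu1 t).
  exact: (gradient_curves_mdist_growth hX (hconv t1) (hconv t2) gv1 gv2 ga1 ga2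
    dist_a rect1 tan1 rect2 tan2 eta0).
- by rewrite s0 lexx.
Qed.
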